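(* Let $0\le R_1<R_2\le+\infty$, $\Omega=\{x\in\mathbb{R}^2:\ R_1<|x|<R_2\}$, $\varepsilon\in\{1,-1\}$, and let $M,N\in\mathbb{R}$ be such that $M+N\ln r>0$ on $(R_1,R_2)$. Consider in $\Omega$ the equation $$\Delta u=\varepsilon|x|^{-2}\left[M+N\ln|x|\right]^{1-q}u|u|^{q-1}.\qquad (E)$$ 1. If $\varepsilon=+1$, then, for every $q>0$, $q\neq1$, any pseudo-radial solution of (E) is radial. 2. If $\varepsilon=-1$, then, for every $q>0$, $q\ne1$, the set of non-radial pseudo-radial solutions of (E) is parameterized by $\mathbb{N}^*=\{1,2,3,\dots\}$ and consists, up to rotation in $\theta$, of the functions $$u_k(x)=\pm\left[M+N\ln|x|\right]w_k(\theta),\qquad k\in\mathbb{N}^*,$$ where, for every $k\in\mathbb{N}^*$, $w_k$ is the unique (up to sign and translation) sign changing solution with least period $\frac{2\pi}{k}$ of the ODE $w''=-w|w|^{q-1}$.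
   Context: $\Delta$ is the Euclidean Laplacian on $\mathbb{R}^2$ and $(r,\theta)$ are polar coordinates, $r=|x|$. Solutions are real-valued classical solutions. A solution $u$ is pseudo-radial if $u(r,\theta)=h(r)w(\theta)$ for some function $h$ on $(R_1,R_2)$ and some $2\pi$-periodic function $w$; it is radial if it does not depend on $\theta$, and non-radial otherwise. Sign changing means taking both positive and negative values. *)

(* Defs.v *)
From Stdlib Require Export Reals.
From Coquelicot Require Export Coquelicot.
Open Scope R_scope.

Definition radius (x y : R) : R := sqrt (x ^ 2 + y ^ 2).

Definition in_range (R1 : R) (R2 : Rbar) (r : R) : Prop :=
  R1 < r /\ Rbar_lt r R2.

Definition annulus (R1 : R) (R2 : Rbar) (x y : R) : Prop :=
  in_range R1 R2 (radius x y).

Definition laplacian (u : R -> R -> R) (x y : R) : R :=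
  partial_derive 2 0 u x y + partial_derive 0 2 u x y.

(* s |s|^(q-1), with value 0 at s = 0 for every q: [Rpower] is total, so the
   factor s decides the value there, also when 0 < q < 1. *)
Definition spow (q s : R) : R := s * Rpower (Rabs s) (q - 1).

(* Functions on the annulus are total functions on R^2 whose values outside
   are irrelevant. As the annulus is open, [ex_diff_n u 2] at each of its
   points means that u is of class C^2 there. *)
Definition classical_solution (R1 : R) (R2 : Rbar) (eps M N q : R)
    (u : R -> R -> R) : Prop :=
  forall x y : R, annulus R1 R2 x y ->
    ex_diff_n u 2 x y /\
    laplacian u x y =
      eps * / (radius x y) ^ 2
      * Rpower (M + N * ln (radius x y)) (1 - q) * spow q (u x y).

Definition pseudo_radial (R1 : R) (R2 : Rbar) (u : R -> R -> R) : Prop :=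
  exists h w : R -> R,
    (forall t, w (t + 2 * PI) = w t) /\
    (forall r t, in_range R1 R2 r ->
       u (r * cos t) (r * sin t) = h r * w t).

Definition radial (R1 : R) (R2 : Rbar) (u : R -> R -> R) : Prop :=
  forall r t t', in_range R1 R2 r ->
    u (r * cos t) (r * sin t) = u (r * cos t') (r * sin t').

Definition positive_period (w : R -> R) (T : R) : Prop :=
  0 < T /\ forall t, w (t + T) = w t.

Definition least_period (w : R -> R) (T : R) : Prop :=
  positive_period w T /\ forall T', positive_period w T' -> T <= T'.

Definition sign_changing (w : R -> R) : Prop :=
  (exists t, 0 < w t) /\ (exists t, w t < 0).

(* w'' = - w |w|^(q-1). The first conjunct is not redundant: [Derive] is total,
   so differentiability of [Derive w] does not give that of w. *)
Definition ode_solution (q : R) (w : R -> R) : Prop :=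
  (forall t, ex_derive w t) /\
  (forall t, is_derive (Derive w) t (- spow q (w t))).

Definition periodic_profile (q : R) (k : nat) (w : R -> R) : Prop :=
  ode_solution q w /\ sign_changing w /\ least_period w (2 * PI / INR k).

(* The argument of (x, y) <> (0, 0), in (-PI, PI]. *)
Definition polar_angle (x y : R) : R :=
  if Rle_dec 0 y then acos (x / radius x y) else - acos (x / radius x y).

Definition profile_function (M N : R) (w : R -> R) (x y : R) : R :=
  (M + N * ln (radius x y)) * w (polar_angle x y).

Definition eq_up_to_sign_and_rotation (R1 : R) (R2 : Rbar)
    (u v : R -> R -> R) : Prop :=
  exists s a : R, (s = 1 \/ s = -1) /\
    forall x y, annulus R1 R2 x y ->
      u x y = s * v (x * cos a - y * sin a) (x * sin a + y * cos a).

(* Main.v *)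
From Stdlib Require Import Lra Lia Psatz ZArith Ranalysis5.
Require Import Defs.

(* In polar coordinates, with [L = M + N ln r], a solution [h(r) w(t)] satisfies
   [(r^2 h'' + r h') w + h w'' = eps L^(1-q) spow h spow w]. If [w] is not
   constant, [w] and [spow w] are linearly independent because [q <> 1], so
   that [|h| / L] takes a single value where [h <> 0]; by continuity [h] is a
   multiple of [L], and a multiple of [w] solves [w'' = eps spow w].
   For [eps = 1] the only periodic solution is [0]. For [eps = -1] all nonzero
   solutions are [l^(2/(q-1)) w0(l t + a)] for one periodic solution [w0] of
   least period [T], and [2 PI]-periodicity means [2 PI l = k T]. *)

(** * The power nonlinearity *)

(** For [0 < q < 1] the nonlinearity is not Lipschitz at [0], a value that every nonzero periodic
    solution crosses, so uniqueness cannot rest on the Cauchy-Lipschitz theorem. It rests on the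
    plane curve [(w, w')]: the energy [2/(q+1) |w|^(q+1) + w'^2] is constant, its level curve meets
    each ray from the origin once, and the angle turns at a speed bounded away from [0]. A solution
    is thus known from its angle.

    The exponent [2/(q-1)] is forced by scaling: [a v(l t)] solves the equation again exactly when
    [l^2 = a^(q-1)]. Since [q <> 1], this reaches every positive energy by varying [l].

    The weight in the equation is matched to [L]: [L] is harmonic ([r^2 L'' + r L' = 0]) and
    [L^(1-q) L^q = L], so the radial variable disappears once [h = c L].

    Two regularity gaps remain. The factors of a pseudo-radial function are arbitrary functions,
    whose smoothness has to be extracted from [u]. Conversely [polar_angle] jumps across the
    negative axis, and the smoothness of [w (polar_angle x y)] comes from the periodicity of [w]. *)

Lemma is_derive_eq (f : R -> R) (x l l' : R) :
  is_derive f x l -> l = l' -> is_derive f x l'.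
Proof. intros H <-; exact H. Qed.

(* [auto_derive] leaves derivatives of abstract functions eta-expanded, which
   keeps [rewrite] with [is_derive_unique] from finding them. *)
Ltac use_derive H :=
  match type of H with
  | is_derive ?f ?x ?l =>
      replace (Derive (fun y : R => f y) x) with l
        by (symmetry; apply is_derive_unique; exact H)
  end.

Lemma derive_zero_const (f : R -> R) :
  (forall t, is_derive f t 0) -> forall a b, f a = f b.
Proof.
  intros H a b.
  destruct (Rtotal_order a b) as [l|[->|l]]; auto.
  - apply (eq_is_derive f a b); [intros t _; apply H|auto].
  - symmetry; apply (eq_is_derive f b a); [intros t _; apply H|auto].
Qed.

Lemma is_derive_continuity_pt (f : R -> R) x l : is_derive f x l -> continuity_pt f x.
Proof.
  intros H. apply derivable_continuous_pt. exists l. now apply is_derive_Reals.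
Qed.

Lemma Rpower_pos x y : 0 < Rpower x y.
Proof. apply exp_pos. Qed.

Lemma Rpower_one_l y : Rpower 1 y = 1.
Proof. unfold Rpower. rewrite ln_1, Rmult_0_r. apply exp_0. Qed.

Lemma Rpower_inj x y z : 0 < x -> 0 < y -> z <> 0 -> Rpower x z = Rpower y z -> x = y.
Proof.
  intros Hx Hy Hz H. apply exp_inv in H.
  apply ln_inv; auto. apply Rmult_eq_reg_l with z; auto.
Qed.

Lemma Rpower_pred a q : 0 < a -> a * Rpower a (q - 1) = Rpower a q.
Proof.
  intros Ha. rewrite <- (Rpower_1 a Ha) at 1. rewrite <- Rpower_plus. f_equal; ring.
Qed.

Lemma spow_0 q : spow q 0 = 0.
Proof. unfold spow; ring. Qed.

Lemma spow_scal q a s : 0 < a -> spow q (a * s) = Rpower a q * spow q s.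
Proof.
  intros Ha. unfold spow.
  destruct (Req_dec s 0) as [->|Hs]; [ring|].
  rewrite Rabs_mult, (Rabs_pos_eq a) by lra.
  rewrite <- Rpower_mult_distr; auto; [|now apply Rabs_pos_lt].
  rewrite <- (Rpower_pred a q) by auto. ring.
Qed.

Lemma spow_opp q s : spow q (- s) = - spow q s.
Proof. unfold spow. rewrite Rabs_Ropp. ring. Qed.

(** Multiplicativity is what separates the variables in [spow q (h r * w t)]. Negative [a] reduces
    to positive [a] by oddness. *)
Lemma spow_mult q a s : spow q (a * s) = spow q a * spow q s.
Proof.
  destruct (Rtotal_order a 0) as [l|[->|l]].
  - replace (a * s) with (- ((- a) * s)) by ring.
    rewrite spow_opp, spow_scal by lra.
    replace (spow q a) with (- Rpower (- a) q); [ring|].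
    unfold spow. rewrite Rabs_left by auto.
    rewrite <- (Rpower_pred (- a) q) by lra. ring.
  - rewrite Rmult_0_l, spow_0; ring.
  - rewrite spow_scal by auto. f_equal. unfold spow.
    rewrite Rabs_pos_eq by lra.
    now rewrite Rpower_pred.
Qed.

Lemma Rabs_spow q s : s <> 0 -> Rabs (spow q s) = Rpower (Rabs s) q.
Proof.
  intros Hs. unfold spow.
  rewrite Rabs_mult, (Rabs_pos_eq (Rpower _ _)) by (left; apply Rpower_pos).
  pose proof (Rabs_pos_lt s Hs).
  now rewrite Rpower_pred.
Qed.

Lemma continuous_spow q s : 0 < q -> continuous (spow q) s.
Proof.
  intros Hq.
  destruct (Req_dec s 0) as [->|Hs].
  - apply continuity_pt_filterlim. intros e He.
    (* Away from [0] the modulus of [spow q x] is [|x|^q], so the radius is the solution of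
       [x^q = e]. *)
    exists (Rpower e (/ q)); split; [apply Rpower_pos|].
    intros x [_ Hx]. simpl in *. unfold R_dist in *.
    rewrite spow_0, Rminus_0_r in *.
    destruct (Req_dec x 0) as [->|Hx0].
    { rewrite spow_0, Rabs_R0; auto. }
    rewrite Rabs_spow by auto.
    replace e with (Rpower (Rpower e (/ q)) q).
    + apply Rlt_Rpower_l; auto. split; auto. now apply Rabs_pos_lt.
    + rewrite Rpower_mult, Rinv_l, Rpower_1; lra.
  - apply (ex_derive_continuous (V := R_NormedModule) (spow q) s).
    unfold spow, Rpower. auto_derive. auto using Rabs_pos_lt.
Qed.

(** This is [|s|^(q+1)], the potential of the oscillator up to a constant. Written as a product with
    [spow], it takes the right value at [0] although [Rpower] does not vanish there. *)
Definition apow (q s : R) : R := s * spow q s.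

(** At [0] the difference quotient is [spow q h] itself, so the claim there is the continuity of
    [spow]. Elsewhere the explicit formula is differentiated. *)
Lemma is_derive_apow q s : 0 < q -> is_derive (apow q) s ((q + 1) * spow q s).
Proof.
  intros Hq.
  destruct (Req_dec s 0) as [->|Hs].
  - rewrite spow_0. apply is_derive_Reals. intros e He.
    destruct (proj2 (continuity_pt_filterlim _ _) (continuous_spow q 0 Hq) e He)
      as [d [Hd H]].
    exists (mkposreal d Hd). intros h Hh Hhd. simpl in *. unfold R_dist in *.
    unfold apow. rewrite Rplus_0_l, Rmult_0_l.
    replace ((h * spow q h - 0) / h - (q + 1) * 0) with (spow q h - spow q 0)
      by (rewrite spow_0; field; auto).
    apply H. split; [split; [exact I|auto]|]. now rewrite Rminus_0_r.
  - unfold apow, spow, Rpower. auto_derive.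
    + auto using Rabs_pos_lt.
    + assert (Ha := Rabs_pos_lt s Hs).
      assert (E : sign s / Rabs s = / s).
      { destruct (Rtotal_order s 0) as [l|[l|l]]; [|lra|].
        - rewrite sign_eq_m1, Rabs_left by auto. field; lra.
        - rewrite sign_eq_1, Rabs_pos_eq by lra. field; lra. }
      generalize (exp ((q - 1) * ln (Rabs s))); intros z.
      transitivity (2 * s * z + s * s * (sign s / Rabs s) * (q - 1) * z);
        [unfold Rdiv; ring|rewrite E; field; auto].
Qed.

Lemma apow_nonneg q s : 0 <= apow q s.
Proof.
  unfold apow, spow. rewrite <- Rmult_assoc.
  apply Rmult_le_pos; [nra|left; apply Rpower_pos].
Qed.

Lemma apow_pos q s : s <> 0 -> 0 < apow q s.
Proof.
  intros. unfold apow, spow. rewrite <- Rmult_assoc.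
  apply Rmult_lt_0_compat; [nra|apply Rpower_pos].
Qed.

Lemma apow_scal q a s : 0 < a -> apow q (a * s) = Rpower a (q + 1) * apow q s.
Proof.
  intros. unfold apow. rewrite spow_scal by auto.
  rewrite Rpower_plus, Rpower_1 by auto. ring.
Qed.

Lemma apow_le_1 q s : 0 < q -> Rabs s <= 1 -> apow q s <= 1.
Proof.
  intros Hq Hs. destruct (Req_dec s 0) as [->|H0].
  { unfold apow; lra. }
  assert (E : apow q s = Rabs s * Rabs (spow q s)).
  { rewrite <- Rabs_mult. symmetry. apply Rabs_pos_eq, apow_nonneg. }
  rewrite E, Rabs_spow by auto.
  assert (Ha := Rabs_pos_lt s H0).
  assert (Rpower (Rabs s) q <= 1).
  { rewrite <- (Rpower_one_l q). apply Rle_Rpower_l; lra. }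
  assert (0 < Rpower (Rabs s) q) by apply Rpower_pos. nra.
Qed.

(** * Inverse functions and angle lifts *)

(** The lower bound [d] on the slope gives everything: injectivity, unbounded growth in both
    directions (hence surjectivity), and the Lipschitz constant [1/d] of the inverse. *)
Lemma inverse_function (F f : R -> R) (d : R) :
  0 < d -> (forall x, is_derive F x (f x)) -> (forall x, d <= f x) ->
  exists G : R -> R,
    (forall y, F (G y) = y) /\ (forall x, G (F x) = x) /\
    (forall y, is_derive G y (/ f (G y))).
Proof.
  intros Hd HF Hf.
  assert (Hinc : forall a b, a <= b -> d * (b - a) <= F b - F a).
  { intros a b [l| ->]; [|lra].
    destruct (MVT_cor2 F f a b l) as [c [E _]].
    { intros c _. now apply is_derive_Reals. }
    rewrite E. specialize (Hf c). nra. }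
  assert (HC : continuity F).
  { intros x. eapply is_derive_continuity_pt, HF. }
  assert (Hs : forall y, {x | F x = y}).
  (* Growing at rate at least [d], [F] covers the distance from [F 0] to [y] within [[-k, k]]. *)
  { intros y. set (k := Rabs (y - F 0) / d).
    assert (Hk : 0 <= k).
    { apply Rmult_le_pos; [apply Rabs_pos|]. left; now apply Rinv_0_lt_compat. }
    assert (Hdk : d * k = Rabs (y - F 0)) by (unfold k; field; lra).
    destruct (IVT_gen F (- k) k y HC) as [x [_ Hx]]; [|now exists x].
    assert (H1 := Hinc (-k) 0). assert (H2 := Hinc 0 k).
    assert (Ha := Rle_abs (y - F 0)). assert (Hb := Rle_abs (-(y - F 0))).
    rewrite Rabs_Ropp in Hb.
    rewrite Rmin_left, Rmax_right; nra. }
  assert (Hinj : forall a b, F a = F b -> a = b).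
  { intros a b E. destruct (Rle_lt_dec a b) as [l|l].
    - specialize (Hinc a b l). nra.
    - assert (H := Hinc b a (Rlt_le _ _ l)). nra. }
  set (G := fun y => proj1_sig (Hs y)).
  assert (FG : forall y, F (G y) = y) by (intros y; unfold G; now destruct (Hs y)).
  assert (GF : forall x, G (F x) = x) by (intros; apply Hinj, FG).
  exists G; split; [exact FG|split; [exact GF|]].
  assert (Lip : forall a b, d * Rabs (G b - G a) <= Rabs (b - a)).
  { intros a b. rewrite <- (FG a), <- (FG b) at 2.
    destruct (Rle_lt_dec (G a) (G b)) as [l|l].
    - specialize (Hinc _ _ l). rewrite !Rabs_pos_eq; nra.
    - assert (H := Hinc _ _ (Rlt_le _ _ l)).
      rewrite (Rabs_minus_sym (G b)), (Rabs_minus_sym (F (G b))).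
      rewrite !Rabs_pos_eq; nra. }
  intros y. set (x0 := G y).
  assert (Hf0 : 0 < f x0) by (specialize (Hf x0); lra).
  apply is_derive_Reals. intros e He.
  (* The error of the inverse slope is that of [h / k] multiplied by [k / (h f)], which the
     Lipschitz bound keeps below [1 / (d f)]; hence this tolerance for [F]. *)
  assert (He' : 0 < e * d * f x0) by (apply Rmult_lt_0_compat; nra).
  destruct (proj1 (is_derive_Reals _ _ _) (HF x0) (e * d * f x0) He') as [r Hr].
  assert (Hdr : 0 < d * r) by (destruct r; simpl; nra).
  exists (mkposreal _ Hdr). simpl. intros h Hh Hhr.
  set (k := G (y + h) - x0).
  assert (HFk : F (x0 + k) - F x0 = h).
  { unfold k, x0. replace (G y + (G (y + h) - G y)) with (G (y + h)) by ring.
    rewrite !FG. ring. }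
  assert (Hk : k <> 0).
  { intros E. rewrite E, Rplus_0_r in HFk. lra. }
  assert (Hkl : d * Rabs k <= Rabs h).
  { unfold k, x0. replace h with ((y + h) - y) at 2 by ring. apply Lip. }
  assert (Hkr : Rabs k < r) by nra.
  specialize (Hr k Hk Hkr). rewrite HFk in Hr. fold x0; fold k.
  replace (k / h - / f x0) with (- (k / h / f x0) * (h / k - f x0)) by (field; auto with real).
  rewrite Rabs_mult, Rabs_Ropp.
  assert (Hkh : Rabs (k / h / f x0) <= / d / f x0).
  { unfold Rdiv. rewrite !Rabs_mult, (Rabs_pos_eq (/ f x0))
      by (left; now apply Rinv_0_lt_compat).
    apply Rmult_le_compat_r; [left; now apply Rinv_0_lt_compat|].
    rewrite Rabs_inv. assert (0 < Rabs h) by now apply Rabs_pos_lt.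
    apply Rmult_le_reg_l with d; auto. apply Rmult_le_reg_r with (Rabs h); auto.
    replace (d * (Rabs k * / Rabs h) * Rabs h) with (d * Rabs k) by (field; lra).
    replace (d * / d * Rabs h) with (Rabs h) by (field; lra). auto. }
  assert (Hp : 0 < / d / f x0) by (apply Rdiv_lt_0_compat; auto; now apply Rinv_0_lt_compat).
  apply Rle_lt_trans with (/ d / f x0 * Rabs (h / k - f x0)).
  { apply Rmult_le_compat_r; auto. apply Rabs_pos. }
  apply Rlt_le_trans with (/ d / f x0 * (e * d * f x0)).
  { apply Rmult_lt_compat_l; auto. }
  right. field; split; lra.
Qed.

Lemma is_derive_primitive (f : R -> R) (a : R) :
  (forall x, continuous f x) -> forall x, is_derive (fun x => RInt f a x) x (f x).
Proof.
  intros Hf x. apply (is_derive_RInt f _ a); auto.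
  apply filter_forall. intros b. apply (RInt_correct (V := R_CompleteNormedModule)).
  apply (ex_RInt_continuous (V := R_CompleteNormedModule)). auto.
Qed.

(** At the origin both sides vanish whatever the angle is, so the identity covers the whole
    plane. *)
Lemma polar_angle_spec x y :
  x = radius x y * cos (polar_angle x y) /\ y = radius x y * sin (polar_angle x y).
Proof.
  unfold polar_angle. set (r := radius x y).
  assert (Hr2 : r * r = x ^ 2 + y ^ 2) by (apply sqrt_sqrt; nra).
  assert (Hr0 : 0 <= r) by apply sqrt_pos.
  destruct Hr0 as [Hr|Hr]; [|rewrite <- Hr in *; nra].
  assert (Hb : -1 <= x / r <= 1).
  { assert (- r <= x <= r) by nra.
    split; [apply Rle_div_r|apply Rle_div_l]; lra. }
  assert (Hs : r * sqrt (1 - Rsqr (x / r)) = Rabs y).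
  { rewrite <- (Rabs_pos_eq r) at 1 by lra. rewrite <- !sqrt_Rsqr_abs.
    rewrite <- sqrt_mult; unfold Rsqr; try nra.
    f_equal. replace (r * r * (1 - x / r * (x / r))) with (r * r - x * x) by (field; lra).
    rewrite Hr2; ring. }
  destruct (Rle_dec 0 y) as [l|l].
  - rewrite cos_acos, sin_acos, Hs, Rabs_pos_eq by auto.
    split; auto. field; lra.
  - rewrite cos_neg, sin_neg, cos_acos, sin_acos by auto.
    rewrite Rabs_left in Hs by lra. split; [field|]; lra.
Qed.

(* With [z = v + i v'], the lift is an antiderivative of [Im (z' / z)];
   then [z e^(-i phi)] solves a linear equation with the real coefficient
   [Re (z' / z)], so it keeps its initial direction. *)
Lemma angle_lift (v v' f : R -> R) :
  (forall t, is_derive v t (v' t)) -> (forall t, is_derive v' t (f t)) ->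
  (forall t, continuous f t) -> (forall t, 0 < v t ^ 2 + v' t ^ 2) ->
  exists phi : R -> R,
    (forall t, is_derive phi t ((v t * f t - v' t ^ 2) / (v t ^ 2 + v' t ^ 2))) /\
    (forall t, v t = sqrt (v t ^ 2 + v' t ^ 2) * cos (phi t) /\
               v' t = sqrt (v t ^ 2 + v' t ^ 2) * sin (phi t)).
Proof.
  intros Hv Hv' Hf Hpos.
  assert (Cv : forall t, continuous v t)
    by (intros t; apply (ex_derive_continuous v); eexists; apply Hv).
  assert (Cv' : forall t, continuous v' t)
    by (intros t; apply (ex_derive_continuous v'); eexists; apply Hv').
  assert (Csq : forall t, continuous (fun t => v t ^ 2 + v' t ^ 2) t).
  { intros t. apply (ex_derive_continuous (fun t => v t ^ 2 + v' t ^ 2)).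
    auto_derive. repeat split; eexists; [apply Hv|apply Hv']. }
  assert (Cinv : forall t, continuous (fun t => / (v t ^ 2 + v' t ^ 2)) t).
  { intros t. apply (continuous_comp _ Rinv); auto.
    apply (ex_derive_continuous Rinv). auto_derive. specialize (Hpos t); lra. }
  set (om := fun t => (v t * f t - v' t ^ 2) / (v t ^ 2 + v' t ^ 2)).
  set (ka := fun t => (v t * v' t + v' t * f t) / (v t ^ 2 + v' t ^ 2)).
  assert (Com : forall t, continuous om t).
  { intros t. apply (continuous_mult (K := R_AbsRing)); auto.
    apply (continuous_minus (V := R_NormedModule)).
    - now apply (continuous_mult (K := R_AbsRing)).
    - apply (continuous_ext (fun t => v' t * v' t)); [intros; simpl; ring|].
      now apply (continuous_mult (K := R_AbsRing)). }
  assert (Cka : forall t, continuous ka t).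
  { intros t. apply (continuous_mult (K := R_AbsRing)); auto.
    apply (continuous_plus (V := R_NormedModule));
    now apply (continuous_mult (K := R_AbsRing)). }
  destruct (polar_angle_spec (v 0) (v' 0)) as [E1 E2].
  set (t0 := polar_angle (v 0) (v' 0)) in *.
  set (phi := fun t => t0 + RInt om 0 t).
  set (K := fun t => RInt ka 0 t).
  assert (Dphi : forall t, is_derive phi t (om t)).
  { intros t. unfold phi. eapply is_derive_eq.
    - apply (is_derive_plus (fun _ => t0)); [apply (is_derive_const (V := R_NormedModule))|].
      now apply is_derive_primitive.
    - apply Rplus_0_l. }
  assert (DK : forall t, is_derive K t (ka t)) by (intros; now apply is_derive_primitive).
  assert (K0 : K 0 = 0) by (apply (RInt_point (V := R_CompleteNormedModule))).
  assert (P0 : phi 0 = t0).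
  { unfold phi. rewrite (RInt_point (V := R_CompleteNormedModule)). apply Rplus_0_r. }
  set (r0 := radius (v 0) (v' 0)) in *.
  assert (Hr0 : 0 < r0) by (apply sqrt_lt_R0, Hpos).
  clearbody r0 t0.
  (* [P + i Q = z e^(-i phi)], and [exp (- K)] is the integrating factor that makes it constant,
     equal to its initial value [r0 > 0]. *)
  set (P := fun t => v t * cos (phi t) + v' t * sin (phi t)).
  set (Q := fun t => v' t * cos (phi t) - v t * sin (phi t)).
  assert (HP : forall t, P t * exp (- K t) = r0).
  { intros t. transitivity (P 0 * exp (- K 0)).
    - apply (derive_zero_const (fun t => P t * exp (- K t))). intros s.
      unfold P. specialize (Hpos s).
      auto_derive; [repeat split; eexists; auto|].
      use_derive (Hv s); use_derive (Hv' s); use_derive (Dphi s); use_derive (DK s).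
      unfold om, ka. field. lra.
    - rewrite K0, Ropp_0, exp_0. unfold P. rewrite P0.
      rewrite E1, E2.
      transitivity (r0 * (Rsqr (sin t0) + Rsqr (cos t0))); [unfold Rsqr; ring|].
      rewrite sin2_cos2; ring. }
  assert (HQ : forall t, Q t * exp (- K t) = 0).
  { intros t. transitivity (Q 0 * exp (- K 0)).
    - apply (derive_zero_const (fun t => Q t * exp (- K t))). intros s.
      unfold Q. specialize (Hpos s).
      auto_derive; [repeat split; eexists; auto|].
      use_derive (Hv s); use_derive (Hv' s); use_derive (Dphi s); use_derive (DK s).
      unfold om, ka. field. lra.
    - rewrite K0, Ropp_0, exp_0. unfold Q. rewrite P0.
      rewrite E1, E2. ring. }
  exists phi; split; auto. intros t.
  specialize (HP t). specialize (HQ t).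
  assert (He := exp_pos (- K t)).
  assert (PP : 0 < P t) by nra.
  assert (QQ : Q t = 0) by nra.
  assert (SC := sin2_cos2 (phi t)). unfold Rsqr in SC.
  assert (V1 : v t = P t * cos (phi t)).
  { transitivity (P t * cos (phi t) - Q t * sin (phi t)); [|rewrite QQ; ring].
    unfold P, Q. transitivity (v t * (sin (phi t) * sin (phi t) + cos (phi t) * cos (phi t)));
      [rewrite SC|]; ring. }
  assert (V2 : v' t = P t * sin (phi t)).
  { transitivity (P t * sin (phi t) + Q t * cos (phi t)); [|rewrite QQ; ring].
    unfold P, Q. transitivity (v' t * (sin (phi t) * sin (phi t) + cos (phi t) * cos (phi t)));
      [rewrite SC|]; ring. }
  assert (S : sqrt (v t ^ 2 + v' t ^ 2) = P t).
  { replace (v t ^ 2 + v' t ^ 2) with (P t * P t).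
    - apply sqrt_square; lra.
    - rewrite V1, V2. transitivity (P t * P t * (sin (phi t) * sin (phi t) + cos (phi t) * cos (phi t)));
      [rewrite SC|]; ring. }
  rewrite S; auto.
Qed.

(** * The oscillator [w'' = - spow q w] *)

Lemma cos_shift x : cos (x + 2 * PI) = cos x.
Proof. rewrite <- (cos_period x 1). f_equal; simpl; ring. Qed.

Lemma sin_shift x : sin (x + 2 * PI) = sin x.
Proof. rewrite <- (sin_period x 1). f_equal; simpl; ring. Qed.

Lemma derive_periodic (w w' : R -> R) T :
  (forall t, is_derive w t (w' t)) -> (forall t, w (t + T) = w t) ->
  forall t, w' (t + T) = w' t.
Proof.
  intros Hd HT t. rewrite <- (is_derive_unique w t (w' t) (Hd t)).
  symmetry. apply is_derive_unique.
  apply (is_derive_ext (fun t => w (t + T))); [apply HT|].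
  auto_derive; [eexists; apply Hd|]. use_derive (Hd (t + T)). ring.
Qed.

Lemma sin_0_cos_pos x : sin x = 0 -> 0 < cos x -> exists n : Z, x = IZR n * (2 * PI).
Proof.
  intros Hs Hc. destruct (sin_eq_0_0 x Hs) as [k Hk].
  destruct (Z.Even_or_Odd k) as [[n ->]|[n ->]].
  - exists n. rewrite Hk, mult_IZR. ring.
  - exfalso. rewrite Hk, plus_IZR, mult_IZR in Hc.
    replace ((2 * IZR n + 1) * PI) with (2 * (IZR n * PI) + PI) in Hc by ring.
    rewrite neg_cos, cos_2a in Hc.
    assert (E : sin (IZR n * PI) = 0) by (apply sin_eq_0_1; now exists n).
    rewrite E in Hc. assert (0 <= Rsqr (cos (IZR n * PI))) by apply Rle_0_sqr.
    unfold Rsqr in *. lra.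
Qed.

(** Covers both periodic functions ([b = 0]) and functions that gain a fixed amount per turn, such
    as time as a function of the angle. *)
Lemma shift_Z (F : R -> R) (a b : R) :
  (forall x, F (x + a) = F x + b) -> forall n : Z, forall x, F (x + IZR n * a) = F x + IZR n * b.
Proof.
  intros H n. induction n as [|n IH|n IH] using Z.peano_ind.
  - intros x. now rewrite !Rmult_0_l, !Rplus_0_r.
  - intros x. rewrite succ_IZR.
    replace (x + (IZR n + 1) * a) with ((x + IZR n * a) + a) by ring.
    rewrite H, IH. ring.
  - intros x. rewrite <- Z.sub_1_r, minus_IZR.
    specialize (H (x + (IZR n - 1) * a)). specialize (IH x).
    replace (x + (IZR n - 1) * a + a) with (x + IZR n * a) in H by ring.
    lra.
Qed.

(* The energy curve [2/(q+1) |X|^(q+1) + Y^2 = 1] is parametrized by the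
   angle [phi] along the quasi-homogeneous dilations,
   [X = N^(-1/(q+1)) cos phi], [Y = N^(-1/2) sin phi]; the flow becomes
   [phi' = 1 / g phi] with [g] continuous and bounded away from [0], also
   for [q < 1], where the equation itself is not Lipschitz. *)
Lemma base_solution q : 0 < q ->
  exists (w w' : R -> R) (T : R), 0 < T /\
    (forall t, is_derive w t (w' t)) /\
    (forall t, is_derive w' t (- spow q (w t))) /\
    (forall t, 2 / (q + 1) * apow q (w t) + w' t ^ 2 = 1) /\
    0 < w 0 /\ (exists t, w t < 0) /\
    (forall t, w (t + T) = w t) /\
    (forall T', (forall t, w (t + T') = w t) -> exists n : Z, T' = IZR n * T).
Proof.
  intros Hq. set (c := 2 / (q + 1)).
  assert (Hc : 0 < c) by (apply Rdiv_lt_0_compat; lra).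
  assert (Hcq : c * (q + 1) = 2) by (unfold c; field; lra).
  set (N := fun p => c * apow q (cos p) + sin p ^ 2).
  (* [D] is the common factor that appears on differentiating [X] and [Y]:
     [al N' cos + N sin = D sin] and [- N'/2 sin + N cos = D spow q (cos)]. *)
  set (D := fun p => sin p ^ 2 + c * cos p ^ 2).
  set (al := / (q + 1)).
  assert (Hal : al * (q + 1) = 1) by (unfold al; field; lra).
  assert (HN : forall p, 0 < N p).
  { intros p. unfold N. destruct (Req_dec (cos p) 0) as [E|E].
    - assert (S := sin2_cos2 p). rewrite E in *. unfold apow, Rsqr in *. nra.
    - assert (P := apow_pos q _ E). nra. }
  assert (HN1 : forall p, N p <= c + 1).
  { intros p. unfold N. assert (S := sin2_cos2 p). unfold Rsqr in S.
    assert (apow q (cos p) <= 1).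
    { apply apow_le_1; auto. apply Rabs_le, COS_bound. }
    nra. }
  assert (HD : forall p, Rmin 1 c <= D p).
  { intros p. unfold D. assert (S := sin2_cos2 p). unfold Rsqr in S.
    unfold Rmin; destruct (Rle_dec 1 c); nra. }
  assert (Hm : 0 < Rmin 1 c) by (apply Rmin_pos; lra).
  set (N' := fun p => - 2 * spow q (cos p) * sin p + 2 * sin p * cos p).
  assert (DN : forall p, is_derive N p (N' p)).
  { intros p. unfold N.
    assert (HP := is_derive_apow q (cos p) Hq).
    auto_derive.
    - eexists; apply HP.
    - use_derive HP. unfold N'. transitivity
       (- (c * (q + 1)) * spow q (cos p) * sin p + 2 * sin p * cos p); [ring|].
      rewrite Hcq. ring. }
  set (g := fun p => D p * Rpower (N p) (- (/2 + al))).
  assert (Cg : forall p, continuous g p).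
  { intros p. apply (ex_derive_continuous (V := R_NormedModule) g).
    unfold g, D, Rpower. auto_derive. split; [eexists; apply DN|auto]. }
  set (X := fun p => Rpower (N p) (- al) * cos p).
  set (Y := fun p => Rpower (N p) (- / 2) * sin p).
  assert (BB : forall p, Rpower (N p) (- / 2) * Rpower (N p) (- / 2) = / N p).
  { intros p. rewrite <- Rpower_plus. replace (- / 2 + - / 2) with (- (1)) by field.
    now rewrite Rpower_Ropp, Rpower_1. }
  assert (DX : forall p, is_derive X p (- Y p * g p)).
  { intros p. specialize (DN p). specialize (HN p). unfold X, Y, g.
    unfold Rpower at 1. auto_derive.
    - split; [eexists; apply DN|auto].
    - use_derive DN. fold (Rpower (N p) (- al)).
      replace (Rpower (N p) (- (/ 2 + al))) with (Rpower (N p) (- al) * Rpower (N p) (- /2))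
        by (rewrite <- Rpower_plus; f_equal; ring).
      assert (HB := BB p). generalize (Rpower (N p) (- al)). intros A.
      transitivity (- sin p * D p * A * / N p); [|rewrite <- HB; ring].
      transitivity (- A * (al * N' p * cos p + sin p * N p) * / N p); [field; lra|].
      replace (al * N' p * cos p + sin p * N p) with (sin p * D p); [ring|].
      unfold N', N, D, apow. replace al with (c / 2) by (unfold al, c; field; lra).
      field. }
  assert (DY : forall p, is_derive Y p (spow q (X p) * g p)).
  { intros p. unfold X. rewrite spow_scal, Rpower_mult by apply Rpower_pos.
    specialize (DN p). specialize (HN p). unfold Y, g.
    unfold Rpower at 1. auto_derive.
    - split; [eexists; apply DN|auto].
    - use_derive DN. fold (Rpower (N p) (- / 2)).
      replace (Rpower (N p) (- (/ 2 + al))) with (Rpower (N p) (- al) * Rpower (N p) (- /2))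
        by (rewrite <- Rpower_plus; f_equal; ring).
      assert (AA : Rpower (N p) (- al * q) * Rpower (N p) (- al) = / N p).
      { rewrite <- Rpower_plus. rewrite <- (Rpower_1 (N p)) at 2 by auto.
        rewrite <- Rpower_Ropp. f_equal. nra. }
      revert AA.
      generalize (Rpower (N p) (- al)) (Rpower (N p) (- al * q)) (Rpower (N p) (- /2)).
      intros A A' B AA.
      transitivity (B * D p * spow q (cos p) * / N p); [|rewrite <- AA; ring].
      transitivity (B * (- / 2 * N' p * sin p + cos p * N p) * / N p); [field; lra|].
      replace (- / 2 * N' p * sin p + cos p * N p) with (D p * spow q (cos p)); [ring|].
      unfold N', N, D, apow. field. }
  assert (HE : forall p, c * apow q (X p) + Y p ^ 2 = 1).
  { intros p. unfold X, Y. rewrite apow_scal, Rpower_mult by apply Rpower_pos.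
    replace (- al * (q + 1)) with (- (1)) by lra.
    rewrite Rpower_Ropp, Rpower_1 by auto.
    rewrite Rpow_mult_distr. replace (Rpower (N p) (- / 2) ^ 2) with (/ N p)
      by (rewrite <- (BB p); ring).
    transitivity (N p * / N p); [unfold N; ring|]. apply Rinv_r. specialize (HN p); lra. }
  set (d := Rmin 1 c * Rpower (c + 1) (- (/ 2 + al))).
  assert (Hd : 0 < d) by (apply Rmult_lt_0_compat; [auto|apply Rpower_pos]).
  assert (Hg : forall p, d <= g p).
  { intros p. apply Rmult_le_compat; auto; try (left; auto; apply Rpower_pos).
    rewrite !Rpower_Ropp. apply Rinv_le_contravar; [apply Rpower_pos|].
    apply Rle_Rpower_l; auto.
    assert (0 < al) by (apply Rinv_0_lt_compat; lra). lra. }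
  (* [Th] is the elapsed time as a function of the angle. Its inverse [G] gives the angle at a given
     time, and a full turn lasts [T]. *)
  set (Th := fun x => RInt g 0 x).
  assert (DTh : forall x, is_derive Th x (g x)) by now apply is_derive_primitive.
  assert (Th0 : Th 0 = 0) by apply (RInt_point (V := R_CompleteNormedModule)).
  destruct (inverse_function Th g d Hd DTh Hg) as [G [TG [GT DG]]].
  set (T := Th (2 * PI)).
  assert (HTh : forall x, Th (x + 2 * PI) = Th x + T).
  { intros x. assert (E : Th (x + 2 * PI) - Th x = Th (0 + 2 * PI) - Th 0).
    - apply (derive_zero_const (fun x => Th (x + 2 * PI) - Th x)).
      intros y. auto_derive; [repeat split; eexists; apply DTh|].
      use_derive (DTh y). use_derive (DTh (y + 2 * PI)).
      unfold g, D, N. rewrite sin_shift, cos_shift. ring.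
    - rewrite Rplus_0_l, Th0 in E. fold T in E. lra. }
  assert (HT : 0 < T).
  { destruct (MVT_cor2 Th g 0 (2 * PI)) as [z [E _]].
    - assert (P := PI_RGT_0). lra.
    - intros z _. now apply is_derive_Reals.
    - rewrite Th0, Rminus_0_r in E. unfold T. rewrite E.
      assert (P := PI_RGT_0). specialize (Hg z). nra. }
  assert (G0 : G 0 = 0) by (transitivity (G (Th 0)); [now rewrite Th0|apply GT]).
  assert (Gg : forall t, 0 < g (G t)) by (intros t; specialize (Hg (G t)); lra).
  assert (DW : forall t, is_derive (fun t => X (G t)) t (- Y (G t))).
  { intros t. eapply is_derive_eq; [apply (is_derive_comp X G t); auto|].
    unfold scal; simpl; unfold mult; simpl. specialize (Gg t). field. lra. }
  (* The minus sign is the orientation: [(w, w')] turns clockwise while the parameter [G t]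
     increases. *)
  exists (fun t => X (G t)), (fun t => - Y (G t)), T.
  split; [auto|]. split; [exact DW|]. split; [|split; [|split; [|split; [|split]]]].
  - intros t. eapply is_derive_eq.
    + apply (is_derive_opp (fun t => Y (G t))). apply (is_derive_comp Y G t); auto.
    + unfold scal, opp; simpl; unfold mult; simpl. specialize (Gg t). field. lra.
  - intros t. rewrite <- (HE (G t)). ring.
  - rewrite G0. unfold X. rewrite cos_0, Rmult_1_r. apply Rpower_pos.
  - exists (Th PI). rewrite GT. unfold X. rewrite cos_PI.
    assert (0 < Rpower (N PI) (- al)) by apply Rpower_pos. lra.
  - intros t. replace (G (t + T)) with (G t + 2 * PI).
    + unfold X, N. now rewrite sin_shift, cos_shift.
    + rewrite <- (GT (G t + 2 * PI)). now rewrite HTh, TG.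
  (* A period of [w] is one of [w'] as well, so at time [T'] the curve is back on the positive
     half-axis; its angle is then a multiple of [2 * PI], reached at a multiple of [T]. *)
  - intros T' H.
    assert (HY : Y (G T') = 0).
    { assert (E := derive_periodic (fun t => X (G t)) (fun t => - Y (G t)) T' DW H 0).
      simpl in E. rewrite Rplus_0_l, G0 in E.
      assert (Y 0 = 0) by (unfold Y; rewrite sin_0; ring). lra. }
    assert (HX := H 0). rewrite Rplus_0_l, G0 in HX.
    destruct (sin_0_cos_pos (G T')) as [n Hn].
    + unfold Y in HY. assert (0 < Rpower (N (G T')) (- / 2)) by apply Rpower_pos. nra.
    + unfold X in HX. rewrite cos_0 in HX.
      assert (0 < Rpower (N (G T')) (- al)) by apply Rpower_pos.
      assert (0 < Rpower (N 0) (- al)) by apply Rpower_pos. nra.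
    + exists n. rewrite <- (TG T'), Hn.
      rewrite <- (Rplus_0_l (IZR n * (2 * PI))).
      rewrite (shift_Z Th (2 * PI) T HTh), Th0. ring.
Qed.

(** * Energy conservation, scaling and uniqueness up to translation *)

Lemma energy_derive q (v v' : R -> R) t : 0 < q ->
  is_derive v t (v' t) -> is_derive v' t (- spow q (v t)) ->
  is_derive (fun t => 2 / (q + 1) * apow q (v t) + v' t ^ 2) t 0.
Proof.
  intros Hq Hv Hv'. assert (HP := is_derive_apow q (v t) Hq).
  auto_derive.
  - repeat split; eexists; [apply HP|apply Hv|apply Hv'].
  - use_derive HP. use_derive Hv. use_derive Hv'. field. lra.
Qed.

Lemma energy_neq_0 q x y : 2 / (q + 1) * apow q x + y ^ 2 = 1 -> 0 < x ^ 2 + y ^ 2.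
Proof.
  intros HE. destruct (Req_dec x 0) as [->|Hx]; [|nra].
  unfold apow in HE. nra.
Qed.

(** The quotient is the clockwise angular speed at the point [(x, y)] of the energy curve. The bound
    makes the angle of a trajectory an invertible function of time. *)
Lemma energy_bounds q : 0 < q -> exists d, 0 < d /\ forall x y,
  2 / (q + 1) * apow q x + y ^ 2 = 1 -> d <= (apow q x + y ^ 2) / (x ^ 2 + y ^ 2).
Proof.
  intros Hq. set (c := 2 / (q + 1)).
  assert (Hc : 0 < c) by (apply Rdiv_lt_0_compat; lra).
  (* On the curve [y^2 <= 1] and [|x|^(q+1) <= 1/c]. Raising the latter to the power [2/(q+1)],
     which is [c] again, bounds [x^2]. *)
  set (B := Rpower (/ c) c + 1).
  assert (HB : 0 < B) by (assert (0 < Rpower (/ c) c) by apply Rpower_pos; unfold B; lra).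
  assert (Hm : 0 < Rmin 1 (/ c)) by (apply Rmin_pos; [lra|now apply Rinv_0_lt_compat]).
  exists (Rmin 1 (/ c) / B). split; [now apply Rdiv_lt_0_compat|].
  intros x y HE. assert (Hp := energy_neq_0 q x y HE).
  assert (HP := apow_nonneg q x).
  (* By the energy identity the sum is [(1 - y^2)/c + y^2], a convex combination of [1/c] and
     [1]. *)
  assert (H1 : Rmin 1 (/ c) <= apow q x + y ^ 2).
  { assert (Hcc : c * / c = 1) by (apply Rinv_r; lra).
    assert (E : apow q x + y ^ 2 = / c * (c * apow q x) + y ^ 2) by (rewrite <- Rmult_assoc, Rinv_l; lra).
    rewrite E. replace (c * apow q x) with (1 - y ^ 2) by (fold c in HE; lra).
    assert (0 <= y ^ 2 <= 1) by (fold c in HE; nra).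
    unfold Rmin. destruct (Rle_dec 1 (/ c)); nra. }
  assert (H2 : x ^ 2 + y ^ 2 <= B).
  { assert (y ^ 2 <= 1) by (fold c in HE; nra).
    assert (x ^ 2 <= Rpower (/ c) c); [|unfold B; lra].
    destruct (Req_dec x 0) as [->|Hx].
    { assert (0 < Rpower (/ c) c) by apply Rpower_pos. nra. }
    assert (Ha := Rabs_pos_lt x Hx).
    assert (E : x ^ 2 = Rpower (apow q x) c).
    { assert (E : apow q x = Rpower (Rabs x) (q + 1)).
      { rewrite Rpower_plus, Rpower_1, <- Rabs_spow, <- Rabs_mult, Rmult_comm by auto.
        symmetry. now apply Rabs_pos_eq. }
      rewrite E, Rpower_mult. replace ((q + 1) * c) with (INR 2) by (unfold c; simpl; field; lra).
      rewrite Rpower_pow, pow2_abs; auto. }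
    rewrite E. apply Rle_Rpower_l; [lra|]. split; [now apply apow_pos|].
    apply Rmult_le_reg_l with c; auto. rewrite Rinv_r by lra. fold c in HE. nra. }
  apply Rmult_le_reg_r with (x ^ 2 + y ^ 2); auto.
  apply Rle_trans with (Rmin 1 (/ c)).
  - apply Rmult_le_reg_r with B; auto.
    replace (Rmin 1 (/ c) / B * (x ^ 2 + y ^ 2) * B) with (Rmin 1 (/ c) * (x ^ 2 + y ^ 2))
      by (field; lra).
    apply Rmult_le_compat_l; lra.
  - replace ((apow q x + y ^ 2) / (x ^ 2 + y ^ 2) * (x ^ 2 + y ^ 2)) with (apow q x + y ^ 2)
      by (field; lra). auto.
Qed.

(** The energy is strictly increasing along a ray on which it is not identically zero. Two points of
    the curve with the same angle therefore coincide. *)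
Lemma energy_ray q r s C S : 0 < q -> 0 < r -> 0 < s ->
  2 / (q + 1) * apow q (r * C) + (r * S) ^ 2 = 1 ->
  2 / (q + 1) * apow q (s * C) + (s * S) ^ 2 = 1 -> r = s.
Proof.
  intros Hq. assert (Hc : 0 < 2 / (q + 1)) by (apply Rdiv_lt_0_compat; lra).
  set (c := 2 / (q + 1)) in *. clearbody c.
  assert (W : forall r s, 0 < r -> r < s -> c * apow q (r * C) + (r * S) ^ 2 = 1 ->
     c * apow q (s * C) + (s * S) ^ 2 = 1 -> False).
  { clear r s. intros r s Hr Hrs. rewrite !apow_scal by lra. intros E1 E2.
    assert (HP := apow_nonneg q C).
    assert (HR : Rpower r (q + 1) < Rpower s (q + 1)) by (apply Rlt_Rpower_l; lra).
    assert (HS : 0 <= S ^ 2) by nra.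
    assert (Hrs2 : r ^ 2 < s ^ 2) by nra.
    rewrite !Rpow_mult_distr in *.
    destruct (Req_dec (S ^ 2) 0) as [E|E].
    - rewrite E in *. assert (0 < apow q C).
      { destruct HP as [HP|HP]; auto. rewrite <- HP, !Rmult_0_r in E1. lra. }
      assert (Rpower r (q + 1) * apow q C < Rpower s (q + 1) * apow q C)
        by (apply Rmult_lt_compat_r; lra).
      nra.
    - assert (0 < S ^ 2) by lra.
      assert (Rpower r (q + 1) * apow q C <= Rpower s (q + 1) * apow q C)
        by (apply Rmult_le_compat_r; lra).
      nra. }
  intros Hr Hs E1 E2. destruct (Rtotal_order r s) as [l|[l|l]]; auto; exfalso; eauto.
Qed.

(* The equation is autonomous, so the change of time matching the polar angles
   of two trajectories of equal energy has derivative [1]; this gives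
   uniqueness without a Lipschitz condition. *)
Lemma equal_energy_translate q (w w' v v' : R -> R) : 0 < q ->
  (forall t, is_derive w t (w' t)) -> (forall t, is_derive w' t (- spow q (w t))) ->
  (forall t, 2 / (q + 1) * apow q (w t) + w' t ^ 2 = 1) ->
  (forall t, is_derive v t (v' t)) -> (forall t, is_derive v' t (- spow q (v t))) ->
  (forall t, 2 / (q + 1) * apow q (v t) + v' t ^ 2 = 1) ->
  exists a, forall t, v t = w (t + a).
Proof.
  intros Hq Hw Hw' Ew Hv Hv' Ev.
  assert (Cs : forall u u' : R -> R, (forall t, is_derive u t (u' t)) ->
             forall t, continuous (fun t => - spow q (u t)) t).
  { intros u u' Hu t. apply (continuous_opp (V := R_NormedModule) (fun t => spow q (u t))).
    apply (continuous_comp u (spow q)); [|now apply continuous_spow].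
    apply (ex_derive_continuous (V := R_NormedModule) u). eexists; apply Hu. }
  assert (Pw := fun t => energy_neq_0 q _ _ (Ew t)).
  assert (Pv := fun t => energy_neq_0 q _ _ (Ev t)).
  destruct (angle_lift w w' _ Hw Hw' (Cs _ _ Hw) Pw) as [pw [Dw Rw]].
  destruct (angle_lift v v' _ Hv Hv' (Cs _ _ Hv) Pv) as [pv [Dv Rv]].
  destruct (energy_bounds q Hq) as [d [Hd Hb]].
  set (K := fun x y => (apow q x + y ^ 2) / (x ^ 2 + y ^ 2)).
  (* Trajectories turn clockwise, so it is [- pw] that increases, with speed [K]. *)
  destruct (inverse_function (fun t => - pw t) (fun t => K (w t) (w' t)) d Hd)
    as [H [FH [HF DH]]].
  { intros t. eapply is_derive_eq; [apply (is_derive_opp pw); apply Dw|].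
    unfold opp, K, apow; simpl. specialize (Pw t). field. lra. }
  { intros t. now apply Hb. }
  (* The time at which the trajectory of [w] has the angle that [v] has at time [t]. *)
  set (a := fun t => H (- pv t)).
  assert (Pa : forall t, pw (a t) = pv t).
  { intros t. unfold a. specialize (FH (- pv t)). lra. }
  assert (Eq : forall t, v t = w (a t) /\ v' t = w' (a t)).
  { intros t. destruct (Rw (a t)) as [E1 E2]. destruct (Rv t) as [E3 E4].
    rewrite Pa in E1, E2.
    assert (ER : sqrt (w (a t) ^ 2 + w' (a t) ^ 2) = sqrt (v t ^ 2 + v' t ^ 2)).
    { apply (energy_ray q _ _ (cos (pv t)) (sin (pv t))); auto using sqrt_lt_R0.
      - now rewrite <- E1, <- E2.
      - now rewrite <- E3, <- E4. }
    rewrite ER in *. split; congruence. }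
  assert (Da : forall t, is_derive (fun t => a t - t) t 0).
  { intros t. unfold a. assert (DHt := DH (- pv t)). assert (Dvt := Dv t).
    auto_derive.
    - repeat split; eexists; [apply DHt|apply Dvt].
    - use_derive DHt. use_derive Dvt. fold (a t).
      destruct (Eq t) as [<- <-]. unfold K, apow. specialize (Pv t).
      assert (0 < v t * spow q (v t) + v' t ^ 2).
      { assert (Z := Hb _ _ (Ev t)).
        assert (ZP := apow_nonneg q (v t)). fold (apow q (v t)).
        destruct (Rle_lt_or_eq_dec 0 (apow q (v t) + v' t ^ 2)) as [l|l]; [nra|auto|].
        rewrite <- l in Z. unfold Rdiv in Z. lra. }
      field. lra. }
  exists (a 0). intros t. destruct (Eq t) as [-> _]. f_equal.
  assert (E := derive_zero_const _ Da t 0). lra.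
Qed.

(** The second derivative gains the factor [a b^2] and [spow] the factor [a^q]; the hypothesis on
    [b] equates them. *)
Lemma solution_scale q (v v' : R -> R) a b : 0 < a -> b ^ 2 = Rpower a (q - 1) ->
  (forall t, is_derive v t (v' t)) -> (forall t, is_derive v' t (- spow q (v t))) ->
  (forall t, is_derive (fun t => a * v (b * t)) t (a * b * v' (b * t))) /\
  (forall t, is_derive (fun t => a * b * v' (b * t)) t (- spow q (a * v (b * t)))).
Proof.
  intros Ha Hb Hv Hv'. split; intros t.
  - auto_derive; [eexists; apply Hv|]. use_derive (Hv (b * t)). ring.
  - auto_derive; [eexists; apply Hv'|]. use_derive (Hv' (b * t)).
    rewrite spow_scal, <- Rpower_pred, <- Hb by auto. ring.
Qed.

Lemma solution_rescaled_translate q (w w' v v' : R -> R) : 0 < q -> q <> 1 ->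
  (forall t, is_derive w t (w' t)) -> (forall t, is_derive w' t (- spow q (w t))) ->
  (forall t, 2 / (q + 1) * apow q (w t) + w' t ^ 2 = 1) ->
  (forall t, is_derive v t (v' t)) -> (forall t, is_derive v' t (- spow q (v t))) ->
  (exists t, v t <> 0) ->
  exists l a, 0 < l /\ forall t, v t = Rpower l (2 / (q - 1)) * w (l * t + a).
Proof.
  intros Hq Hq1 Hw Hw' Ew Hv Hv' [t0 Ht0].
  set (c := 2 / (q + 1)).
  assert (Hc : 0 < c) by (apply Rdiv_lt_0_compat; lra).
  set (e := c * apow q (v t0) + v' t0 ^ 2).
  assert (He : 0 < e).
  { unfold e. assert (H := apow_pos q _ Ht0). nra. }
  assert (HE : forall t, c * apow q (v t) + v' t ^ 2 = e).
  { intros t. apply (derive_zero_const (fun t => c * apow q (v t) + v' t ^ 2)).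
    intros s. now apply energy_derive. }
  (* Scaling by [al] multiplies the energy by [al^(q+1)]; this value brings [e] to [1], and [b] is
     the matching change of time. *)
  set (al := Rpower e (- / (q + 1))).
  set (b := Rpower al ((q - 1) / 2)).
  assert (Hal : 0 < al) by apply Rpower_pos.
  assert (Hb0 : 0 < b) by apply Rpower_pos.
  assert (Hb : b ^ 2 = Rpower al (q - 1)).
  { rewrite <- Rpower_pow by auto. unfold b. rewrite Rpower_mult.
    f_equal. simpl. field. }
  assert (Hae : Rpower al (q + 1) * e = 1).
  { unfold al. rewrite Rpower_mult.
    replace (- / (q + 1) * (q + 1)) with (- (1)) by (field; lra).
    rewrite Rpower_Ropp, Rpower_1 by auto. field. lra. }
  destruct (solution_scale q v v' al b Hal Hb Hv Hv') as [DV DV'].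
  destruct (equal_energy_translate q w w' _ _ Hq Hw Hw' Ew DV DV') as [a Ha].
  { intros t. transitivity (Rpower al (q + 1) * e); [|exact Hae].
    rewrite apow_scal by auto. rewrite <- (HE (b * t)).
    rewrite !Rpow_mult_distr, Hb. fold c.
    replace (al ^ 2 * Rpower al (q - 1)) with (Rpower al (q + 1)); [ring|].
    rewrite <- Rpower_pow, <- Rpower_plus by auto. f_equal. simpl; ring. }
  exists (/ b), a. split; [now apply Rinv_0_lt_compat|]. intros t.
  replace (/ b * t + a) with (t / b + a) by (unfold Rdiv; ring).
  rewrite <- Ha. replace (b * (t / b)) with t by (field; lra).
  (* The amplitude is recovered from the frequency [1/b] by inverting [b = al^((q-1)/2)], which is
     where [q <> 1] enters. *)
  replace (Rpower (/ b) (2 / (q - 1))) with (/ al).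
  { rewrite <- Rmult_assoc, Rinv_l by lra. symmetry; apply Rmult_1_l. }
  unfold b. rewrite <- Rpower_Ropp, Rpower_mult.
  rewrite <- (Rpower_1 al) at 1 by auto. rewrite <- Rpower_Ropp. f_equal. field. lra.
Qed.

Lemma periodic_solutions q : 0 < q -> q <> 1 -> exists om : nat -> R -> R,
  (forall k, (1 <= k)%nat -> periodic_profile q k (om k)) /\
  (forall v, ode_solution q v -> (exists t, v t <> 0) -> (forall t, v (t + 2 * PI) = v t) ->
     exists k a, (1 <= k)%nat /\ forall t, v t = om k (t + a)).
Proof.
  intros Hq Hq1.
  destruct (base_solution q Hq) as [w [w' [T [HT [Hw [Hw' [Ew [W0 [[tn Wn] [WT WT']]]]]]]]]].
  assert (HPI := PI_RGT_0).
  (* The frequency that turns the period [T] of [w] into [2 * PI / k]. *)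
  set (la := fun k => INR k * T / (2 * PI)).
  assert (Hla : forall k, (1 <= k)%nat -> 0 < la k).
  { intros k Hk. apply Rdiv_lt_0_compat; [|lra]. apply Rmult_lt_0_compat; auto.
    apply lt_0_INR. lia. }
  assert (HTn : forall n x, 0 < x -> x = IZR n * T -> (1 <= n)%Z).
  { intros n x Hx E. apply Z.lt_pred_le. change (Z.pred 1) with 0%Z. apply lt_IZR. nra. }
  exists (fun k t => Rpower (la k) (2 / (q - 1)) * w (la k * t)). split.
  - intros k Hk. specialize (Hla k Hk).
    assert (Hk0 : 0 < INR k) by (apply lt_0_INR; lia).
    set (l := la k) in *. set (A := Rpower l (2 / (q - 1))).
    assert (HA : 0 < A) by apply Rpower_pos.
    destruct (solution_scale q w w' A l HA) as [D1 D2]; auto.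
    { unfold A. rewrite Rpower_mult, <- Rpower_pow by auto. f_equal. simpl; field. lra. }
    split; [split|split; [split|split; [split|]]].
    + intros t. eexists; apply D1.
    + intros t. apply (is_derive_ext (fun t => A * l * w' (l * t))); auto.
      intros s. symmetry. apply is_derive_unique, D1.
    + exists 0. rewrite Rmult_0_r. now apply Rmult_lt_0_compat.
    + exists (tn / l). replace (l * (tn / l)) with tn by (field; lra). nra.
    + apply Rdiv_lt_0_compat; lra.
    + intros t. f_equal. replace (l * (t + 2 * PI / INR k)) with (l * t + T); auto.
      unfold l, la. field. lra.
    + intros T' [HT' P]. destruct (WT' (l * T')) as [n Hn].
      { intros s. specialize (P (s / l)). apply Rmult_eq_reg_l in P; [|lra].
        replace (l * (s / l + T')) with (s + l * T') in P by (field; lra).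
        now replace (l * (s / l)) with s in P by (field; lra). }
      assert (H1 : (1 <= n)%Z) by (apply (HTn n (l * T')); nra).
      apply IZR_le in H1. apply Rmult_le_reg_l with l; auto.
      rewrite Hn. replace (l * (2 * PI / INR k)) with T by (unfold l, la; field; lra). nra.
  - intros v [V1 V2] Vn VP.
    destruct (solution_rescaled_translate q w w' v (Derive v)) as [l [a [Hl E]]]; auto.
    { intros t. apply Derive_correct, V1. }
    assert (HA : 0 < Rpower l (2 / (q - 1))) by apply Rpower_pos.
    (* In the time of [w], the period [2 * PI] of [v] becomes [l * (2 * PI)], hence a multiple
       [n * T]; this says [l = la n], and positivity gives [n >= 1]. *)
    destruct (WT' (l * (2 * PI))) as [n Hn].
    { intros s. specialize (VP ((s - a) / l)). rewrite !E in VP.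
      apply Rmult_eq_reg_l in VP; [|lra].
      replace (l * ((s - a) / l + 2 * PI) + a) with (s + l * (2 * PI)) in VP by (field; lra).
      now replace (l * ((s - a) / l) + a) with s in VP by (field; lra). }
    assert (H1 : (1 <= n)%Z) by (apply (HTn n (l * (2 * PI))); nra).
    exists (Z.to_nat n), (a / l). split; [lia|]. intros t.
    assert (El : la (Z.to_nat n) = l).
    { unfold la. rewrite INR_IZR_INZ, Z2Nat.id by lia. rewrite <- Hn. field. lra. }
    rewrite El, E. do 2 f_equal. field. lra.
Qed.

(** * Separation of variables *)

Lemma ivt_between (f : R -> R) a b y :
  (forall x, Rmin a b <= x <= Rmax a b -> continuity_pt f x) ->
  Rmin (f a) (f b) < y < Rmax (f a) (f b) ->
  exists x, Rmin a b <= x <= Rmax a b /\ f x = y.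
Proof.
  assert (W : forall (f : R -> R) a b y, a < b ->
    (forall x, a <= x <= b -> continuity_pt f x) -> f a < y -> y < f b ->
    exists x, a <= x <= b /\ f x = y).
  { clear. intros f a b y Hab Hf Ha Hb.
    destruct (IVT_interv (fun x => f x - y) a b) as [x [Hx E]]; try lra.
    - intros x Hx. apply continuity_pt_minus; [auto|].
      apply continuity_pt_const. intros ? ?; auto.
    - exists x. split; auto. lra. }
  assert (W2 : forall (f : R -> R) a b y, a < b ->
    (forall x, a <= x <= b -> continuity_pt f x) -> Rmin (f a) (f b) < y < Rmax (f a) (f b) ->
    exists x, a <= x <= b /\ f x = y).
  { clear - W. intros f a b y Hab Hf Hy.
    destruct (Rle_lt_dec (f a) (f b)) as [l|l].
    - rewrite Rmin_left, Rmax_right in Hy by auto. apply W; tauto.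
    - rewrite Rmin_right, Rmax_left in Hy by lra.
      destruct (W (fun x => - f x) a b (- y)) as [x [Hx E]]; auto; try lra.
      + intros x Hx. apply continuity_pt_opp. auto.
      + exists x. split; auto. lra. }
  intros Hf Hy. destruct (Rtotal_order a b) as [l|[->|l]].
  - rewrite Rmin_left, Rmax_right in * by lra. auto.
  - unfold Rmin, Rmax in Hy. destruct (Rle_dec (f b) (f b)); lra.
  - rewrite Rmin_right, Rmax_left in * by lra.
    rewrite Rmin_comm, Rmax_comm in Hy. auto.
Qed.

(** The point [b] itself works unless [f b] is [0] or [- f a]; in these two cases the intermediate
    value [f a / 2] is attained on the way. *)
Lemma exists_distinct_abs (f : R -> R) a b :
  (forall x, Rmin a b <= x <= Rmax a b -> continuity_pt f x) ->
  f a <> 0 -> f b <> f a ->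
  exists x, Rmin a b <= x <= Rmax a b /\ f x <> 0 /\ Rabs (f x) <> Rabs (f a).
Proof.
  intros Hf Ha Hab.
  assert (Hb : Rmin a b <= b <= Rmax a b) by (split; [apply Rmin_r|apply Rmax_r]).
  destruct (Req_dec (f b) 0) as [E|E]; [|destruct (Req_dec (Rabs (f b)) (Rabs (f a))) as [E'|E']].
  3: now exists b.
  2: assert (f b = - f a) by (unfold Rabs in E'; destruct (Rcase_abs (f a)), (Rcase_abs (f b)); lra).
  all: destruct (ivt_between f a b (f a / 2) Hf) as [x [Hx Ex]];
    [unfold Rmin, Rmax; destruct (Rle_dec (f a) (f b)); lra|].
  all: exists x; rewrite Ex; split; auto; split; [lra|].
  all: unfold Rabs; destruct (Rcase_abs (f a)), (Rcase_abs (f a / 2)); lra.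
Qed.

Lemma in_range_convex R1 R2 a b x :
  in_range R1 R2 a -> in_range R1 R2 b -> Rmin a b <= x <= Rmax a b -> in_range R1 R2 x.
Proof.
  unfold in_range. intros [Ha Ha'] [Hb Hb'] [H1 H2]. split.
  - unfold Rmin in H1; destruct (Rle_dec a b); lra.
  - destruct R2; simpl in *; auto. unfold Rmax in H2; destruct (Rle_dec a b); lra.
Qed.

Lemma in_range_locally R1 R2 r : in_range R1 R2 r -> locally r (in_range R1 R2).
Proof.
  intros [H1 H2]. apply (locally_interval _ r R1 R2); auto.
  intros y Hy1 Hy2. now split.
Qed.

Lemma in_range_inhabited (R1 : R) R2 : Rbar_lt R1 R2 -> exists r, in_range R1 R2 r.
Proof.
  unfold in_range. destruct R2 as [b| |]; simpl; try tauto; intros H.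
  - exists ((R1 + b) / 2). simpl. lra.
  - exists (R1 + 1). split; [lra|exact I].
Qed.

Lemma radius_polar r t : 0 < r -> radius (r * cos t) (r * sin t) = r.
Proof.
  intros Hr. unfold radius.
  replace ((r * cos t) ^ 2 + (r * sin t) ^ 2) with (r * r * (Rsqr (sin t) + Rsqr (cos t)))
    by (unfold Rsqr; ring).
  rewrite sin2_cos2, Rmult_1_r. apply sqrt_square. lra.
Qed.

(** Dividing by [x] and [y] leaves [a = b |x|^(q-1) = b |y|^(q-1)], and a power with nonzero
    exponent separates [|x|] from [|y|]. *)
Lemma spow_independent q x y a b : q <> 1 -> x <> 0 -> y <> 0 -> Rabs x <> Rabs y ->
  a * x = b * spow q x -> a * y = b * spow q y -> a = 0 /\ b = 0.
Proof.
  intros Hq Hx Hy Hxy. unfold spow. intros E1 E2.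
  assert (F1 : a = b * Rpower (Rabs x) (q - 1)).
  { apply Rmult_eq_reg_r with x; auto. rewrite E1. ring. }
  assert (F2 : a = b * Rpower (Rabs y) (q - 1)).
  { apply Rmult_eq_reg_r with y; auto. rewrite E2. ring. }
  assert (Hb : b = 0).
  { destruct (Req_dec b 0) as [|Hb]; auto. exfalso. apply Hxy.
    apply (Rpower_inj _ _ (q - 1)); auto using Rabs_pos_lt; [lra|].
    apply Rmult_eq_reg_l with b; congruence. }
  split; auto. rewrite F1, Hb. ring.
Qed.

Lemma separation R1 R2 eps M N q (h h1 h2 w w1 w2 : R -> R) r0 ta tb :
  0 <= R1 -> eps <> 0 -> q <> 1 ->
  (forall r, in_range R1 R2 r -> 0 < M + N * ln r) ->
  (forall r, in_range R1 R2 r -> is_derive h r (h1 r)) ->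
  (forall r, in_range R1 R2 r -> is_derive h1 r (h2 r)) ->
  (forall t, is_derive w t (w1 t)) ->
  (forall r t, in_range R1 R2 r -> r ^ 2 * h2 r * w t + r * h1 r * w t + h r * w2 t =
     eps * Rpower (M + N * ln r) (1 - q) * spow q (h r * w t)) ->
  in_range R1 R2 r0 -> h r0 <> 0 -> w ta <> w tb ->
  exists c, c <> 0 /\
    (forall r, in_range R1 R2 r -> h r = c * (M + N * ln r)) /\
    (forall t, c * w2 t = eps * spow q (c * w t)).
Proof.
  intros HR1 He Hq HL Dh Dh1 Dw Heq Hr0 Hh0 Hw.
  assert (Hpair : exists t1 t2, w t1 <> 0 /\ w t2 <> 0 /\ Rabs (w t1) <> Rabs (w t2)).
  { assert (Cw : forall x, continuity_pt w x) by (intros x; eapply is_derive_continuity_pt, Dw).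
    destruct (Req_dec (w ta) 0) as [E|E].
    - destruct (exists_distinct_abs w tb ta) as [x [_ [X1 X2]]]; auto; [congruence|].
      exists tb, x. repeat split; auto. congruence.
    - destruct (exists_distinct_abs w ta tb) as [x [_ [X1 X2]]]; auto.
      exists ta, x. repeat split; auto. }
  destruct Hpair as [t1 [t2 [Ht1 [Ht2 Ht12]]]].
  set (L := fun r => M + N * ln r).
  assert (HLr : forall r, in_range R1 R2 r -> 0 < L r) by exact HL.
  assert (Habs : forall r, in_range R1 R2 r -> h r <> 0 ->
    Rabs (h r / L r) = Rabs (h r0 / L r0)).
  { intros r Hr Hhr.
    (* Divided by [h r], the equation reads [w2 = B r * spow q w - A r * w]. The left side does not
       depend on [r], so independence gives [B r = B r0], and [B] is [eps (|h|/L)^(q-1)]. *)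
    set (A := fun r => (r ^ 2 * h2 r + r * h1 r) / h r).
    set (B := fun r => eps * Rpower (L r) (1 - q) * Rpower (Rabs (h r)) (q - 1)).
    assert (HAB : forall r t, in_range R1 R2 r -> h r <> 0 -> w2 t = B r * spow q (w t) - A r * w t).
    { intros s t Hs Hhs. apply Rmult_eq_reg_l with (h s); auto.
      specialize (Heq s t Hs). rewrite spow_mult in Heq. fold (L s) in Heq.
      transitivity (eps * Rpower (L s) (1 - q) * (spow q (h s) * spow q (w t))
                    - (s ^ 2 * h2 s + s * h1 s) * w t); [lra|].
      unfold A, B. unfold spow at 1. field. auto. }
    destruct (spow_independent q (w t1) (w t2) (A r - A r0) (B r - B r0)) as [_ E]; auto.
    { assert (E1 := HAB r t1 Hr Hhr). assert (E2 := HAB r0 t1 Hr0 Hh0). lra. }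
    { assert (E1 := HAB r t2 Hr Hhr). assert (E2 := HAB r0 t2 Hr0 Hh0). lra. }
    assert (HB : forall r, in_range R1 R2 r -> h r <> 0 -> B r = eps * Rpower (Rabs (h r / L r)) (q - 1)).
    { intros s Hs Hhs. unfold B. specialize (HLr s Hs).
      unfold Rdiv. rewrite Rabs_mult, Rabs_inv, (Rabs_pos_eq (L s)) by lra.
      rewrite <- Rpower_mult_distr; [|now apply Rabs_pos_lt|now apply Rinv_0_lt_compat].
      replace (Rpower (/ L s) (q - 1)) with (Rpower (L s) (1 - q)); [ring|].
      unfold Rpower. rewrite ln_Rinv by auto. f_equal. ring. }
    assert (Hne : forall r, in_range R1 R2 r -> h r <> 0 -> h r / L r <> 0).
    { intros s Hs Hhs. specialize (HLr s Hs). unfold Rdiv.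
      apply Rmult_integral_contrapositive. split; auto. apply Rinv_neq_0_compat. lra. }
    rewrite !HB in E by auto.
    apply (Rpower_inj _ _ (q - 1)); auto using Rabs_pos_lt; [lra|].
    apply Rmult_eq_reg_l with eps; auto. lra. }
  set (c := h r0 / L r0).
  assert (Hc : c <> 0).
  { unfold c, Rdiv. apply Rmult_integral_contrapositive. split; auto.
    apply Rinv_neq_0_compat. specialize (HLr r0 Hr0). lra. }
  assert (Hh : forall r, in_range R1 R2 r -> h r = c * L r).
  { intros r Hr. assert (HLp := HLr r Hr).
    destruct (Req_dec (h r / L r) c) as [E|E].
    { rewrite <- E. field. lra. }
    (* Any other value of [h / L] at [r], zero or [- c] included, would force between [r0] and [r] a
       nonzero value of modulus different from [|c|], against [Habs]. *)
    exfalso. destruct (exists_distinct_abs (fun r => h r / L r) r0 r) as [x [Hx [X1 X2]]]; auto.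
    - intros x Hx. assert (Hxr := in_range_convex _ _ _ _ _ Hr0 Hr Hx).
      apply is_derive_continuity_pt with
        ((h1 x * L x - h x * (N / x)) / L x ^ 2).
      assert (Dx := Dh x Hxr). assert (Lx := HLr x Hxr). unfold L in *.
      assert (0 < x) by (destruct Hxr; lra).
      auto_derive; [repeat split; auto; [eexists; apply Dx|lra]|].
      use_derive Dx. field. lra.
    - simpl in X1. assert (Hxr := in_range_convex _ _ _ _ _ Hr0 Hr Hx).
      apply X2. apply Habs; auto. intros E0. apply X1. rewrite E0. unfold Rdiv; ring. }
  exists c. split; [auto|]. split; [exact Hh|].
  assert (Hpos : forall r, in_range R1 R2 r -> 0 < r) by (intros r [H _]; lra).
  assert (E1 : forall r, in_range R1 R2 r -> h1 r = c * N / r).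
  { intros r Hr. rewrite <- (is_derive_unique h r (h1 r) (Dh r Hr)).
    apply is_derive_unique. apply (is_derive_ext_loc (fun r => c * L r)).
    - generalize (in_range_locally _ _ _ Hr). apply filter_imp. intros s Hs. now rewrite Hh.
    - unfold L. specialize (Hpos r Hr). auto_derive; auto. field. lra. }
  assert (E2 : forall r, in_range R1 R2 r -> h2 r = - c * N / r ^ 2).
  { intros r Hr. rewrite <- (is_derive_unique h1 r (h2 r) (Dh1 r Hr)).
    apply is_derive_unique. apply (is_derive_ext_loc (fun r => c * N / r)).
    - generalize (in_range_locally _ _ _ Hr). apply filter_imp. intros s Hs. now rewrite E1.
    - specialize (Hpos r Hr). auto_derive; [lra|]. field. lra. }
  (* With [h = c L] the radial terms cancel by harmonicity of [L], and one radius is enough to read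
     off the equation for [c * w]. *)
  intros t. specialize (Heq r0 t Hr0). fold (L r0) in Heq.
  specialize (Hpos r0 Hr0). specialize (HLr r0 Hr0).
  rewrite E1, E2, Hh in Heq by auto.
  replace (c * L r0 * w t) with (L r0 * (c * w t)) in Heq by ring.
  rewrite spow_scal in Heq by exact HLr.
  apply Rmult_eq_reg_l with (L r0); [|lra].
  transitivity (eps * (Rpower (L r0) (1 - q) * Rpower (L r0) q) * spow q (c * w t)).
  - rewrite <- Rmult_assoc in Heq. rewrite <- (Rmult_assoc eps), <- Heq. field. lra.
  - rewrite <- Rpower_plus. replace (1 - q + q) with 1 by ring. rewrite Rpower_1 by auto. ring.
Qed.

(** * The Laplacian in polar coordinates and the reduction of pseudo-radial solutions *)

Lemma continuity_2d_radius x y : continuity_2d_pt radius x y.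
Proof.
  apply (continuity_1d_2d_pt_comp sqrt (fun x y => x ^ 2 + y ^ 2)).
  - apply continuity_pt_filterlim, continuous_sqrt.
  - apply (continuity_2d_pt_ext (fun x y => x * x + y * y)); [intros; ring|].
    apply continuity_2d_pt_plus; apply continuity_2d_pt_mult;
      auto using continuity_2d_pt_id1, continuity_2d_pt_id2.
Qed.

Lemma annulus_locally R1 R2 x y : annulus R1 R2 x y -> locally_2d (annulus R1 R2) x y.
Proof.
  intros H. apply locally_2d_locally.
  apply (proj1 (continuity_2d_pt_filterlim radius x y) (continuity_2d_radius x y)).
  now apply in_range_locally.
Qed.

Lemma annulus_polar R1 R2 r t : 0 <= R1 -> in_range R1 R2 r ->
  annulus R1 R2 (r * cos t) (r * sin t).
Proof.
  intros H0 H. unfold annulus. rewrite radius_polar; auto. destruct H; lra.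
Qed.

(** Partial derivatives near the point, with the one in [x] continuous there, yield the total
    differentiability that the chain rule in polar coordinates requires. *)
Lemma ex_diff_differentiable_pt_lim u x y : locally_2d (ex_diff_n u 1) x y ->
  differentiable_pt_lim u x y (Derive (fun z => u z y) x) (Derive (fun z => u x z) y).
Proof.
  intros H. apply filterdiff_differentiable_pt_lim.
  assert (H0 := locally_2d_singleton _ _ _ H).
  destruct H0 as [_ [_ [Hy [Hcx _]]]].
  apply (filterdiff_ext_lin _ (fun v : R * R => plus (scal (fst v) (Derive (fun z => u z y) x))
     (scal (snd v) (Derive (fun z => u x z) y)))); [|intros; reflexivity].
  apply (is_derive_filterdiff u x y (fun x y => Derive (fun z => u z y) x)).
  - apply locally_2d_locally in H. generalize H. apply filter_imp.
    intros [a b] [_ [Ha _]]. now apply Derive_correct.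
  - now apply Derive_correct.
  - destruct Hcx as [Hcx _]. now apply continuity_2d_pt_filterlim in Hcx.
Qed.

(** The point is named by equations instead of being substituted, so that [gx] and [gy] can be
    inferred as functions of two variables. *)
Lemma is_derive_polar (g gx gy : R -> R -> R) r t :
  (forall x y, x = r * cos t -> y = r * sin t -> differentiable_pt_lim g x y (gx x y) (gy x y)) ->
  is_derive (fun r => g (r * cos t) (r * sin t)) r
    (gx (r * cos t) (r * sin t) * cos t + gy (r * cos t) (r * sin t) * sin t) /\
  is_derive (fun t => g (r * cos t) (r * sin t)) t
    (gx (r * cos t) (r * sin t) * (- r * sin t) + gy (r * cos t) (r * sin t) * (r * cos t)).
Proof.
  intros H. specialize (H _ _ eq_refl eq_refl). split; apply is_derive_Reals.
  - apply (derivable_pt_lim_comp_2d g (fun r => r * cos t) (fun r => r * sin t)); auto;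
      apply is_derive_Reals; auto_derive; auto; ring.
  - apply (derivable_pt_lim_comp_2d g (fun t => r * cos t) (fun t => r * sin t)); auto;
      apply is_derive_Reals; auto_derive; auto; ring.
Qed.

Lemma is_derive_mult_const_r (f : R -> R) x l k :
  is_derive f x l -> is_derive (fun x => f x * k) x (l * k).
Proof. exact (is_derive_scal_l f x l k). Qed.

(** In [r^2 Urr + Utt] each mixed derivative occurs with coefficients [r^2 cos t sin t] and its
    opposite; the first-order terms of [Utt] cancel [r Ur]. *)
Lemma polar_laplacian R1 R2 u : 0 <= R1 ->
  (forall x y, annulus R1 R2 x y -> ex_diff_n u 2 x y) ->
  exists Ur Urr Ut Utt : R -> R -> R, forall r t, in_range R1 R2 r ->
    is_derive (fun r => u (r * cos t) (r * sin t)) r (Ur r t) /\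
    is_derive (fun r => Ur r t) r (Urr r t) /\
    is_derive (fun t => u (r * cos t) (r * sin t)) t (Ut r t) /\
    is_derive (fun t => Ut r t) t (Utt r t) /\
    r ^ 2 * Urr r t + r * Ur r t + Utt r t = r ^ 2 * laplacian u (r * cos t) (r * sin t).
Proof.
  intros H0 Hu.
  set (dx := fun (f : R -> R -> R) x y => Derive (fun z => f z y) x).
  set (dy := fun (f : R -> R -> R) x y => Derive (fun z => f x z) y).
  assert (Hd : forall f : R -> R -> R, (forall x y, annulus R1 R2 x y -> ex_diff_n f 1 x y) ->
    forall r t, in_range R1 R2 r -> forall x y, x = r * cos t -> y = r * sin t ->
      differentiable_pt_lim f x y (dx f x y) (dy f x y)).
  { intros f Hf r t Hr x y -> ->. apply ex_diff_differentiable_pt_lim.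
    assert (Ha := annulus_locally _ _ _ _ (annulus_polar R1 R2 r t H0 Hr)).
    revert Ha. apply locally_2d_impl, locally_2d_forall. auto. }
  assert (D0 := Hd u (fun x y Hx => ex_diff_n_m 2 1 (le_S _ _ (le_n 1)) _ _ _ (Hu x y Hx))).
  assert (D1 := Hd (dx u) (fun x y Hx => ex_diff_n_deriv_aux1 _ _ _ _ (Hu x y Hx))).
  assert (D2 := Hd (dy u) (fun x y Hx => ex_diff_n_deriv_aux2 _ _ _ _ (Hu x y Hx))).
  set (P := fun (f : R -> R -> R) r t => f (r * cos t) (r * sin t)).
  exists (fun r t => P (dx u) r t * cos t + P (dy u) r t * sin t).
  exists (fun r t => (P (dx (dx u)) r t * cos t + P (dy (dx u)) r t * sin t) * cos t +
                     (P (dx (dy u)) r t * cos t + P (dy (dy u)) r t * sin t) * sin t).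
  exists (fun r t => P (dx u) r t * (- r * sin t) + P (dy u) r t * (r * cos t)).
  exists (fun r t => (P (dx (dx u)) r t * (- r * sin t) + P (dy (dx u)) r t * (r * cos t)) * (- r * sin t)
     + P (dx u) r t * (- r * cos t) +
    ((P (dx (dy u)) r t * (- r * sin t) + P (dy (dy u)) r t * (r * cos t)) * (r * cos t)
     + P (dy u) r t * (- r * sin t))).
  intros r t Hr.
  destruct (is_derive_polar u _ _ r t (D0 r t Hr)) as [Er Et].
  destruct (is_derive_polar (dx u) _ _ r t (D1 r t Hr)) as [Exr Ext].
  destruct (is_derive_polar (dy u) _ _ r t (D2 r t Hr)) as [Eyr Eyt].
  fold (P (dx (dx u)) r t) (P (dy (dx u)) r t) (P (dx (dy u)) r t) (P (dy (dy u)) r t) in Exr, Ext, Eyr, Eyt.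
  change (is_derive (fun r => P (dx u) r t) r (P (dx (dx u)) r t * cos t + P (dy (dx u)) r t * sin t)) in Exr.
  change (is_derive (fun r => P (dy u) r t) r (P (dx (dy u)) r t * cos t + P (dy (dy u)) r t * sin t)) in Eyr.
  split; [exact Er|]. split; [|split; [exact Et|split]].
  - apply (is_derive_plus (fun r => P (dx u) r t * cos t) (fun r => P (dy u) r t * sin t)).
    + apply (is_derive_mult_const_r (fun r => P (dx u) r t)). exact Exr.
    + apply (is_derive_mult_const_r (fun r => P (dy u) r t)). exact Eyr.
  - set (f1 := fun t => P (dx u) r t) in *. set (f2 := fun t => P (dy u) r t) in *.
    change (is_derive (fun t => f1 t * (- r * sin t) + f2 t * (r * cos t)) t
       ((P (dx (dx u)) r t * (- r * sin t) + P (dy (dx u)) r t * (r * cos t)) * (- r * sin t)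
     + f1 t * (- r * cos t) +
    ((P (dx (dy u)) r t * (- r * sin t) + P (dy (dy u)) r t * (r * cos t)) * (r * cos t)
     + f2 t * (- r * sin t)))).
    change (is_derive f1 t (P (dx (dx u)) r t * (- r * sin t) + P (dy (dx u)) r t * (r * cos t))) in Ext.
    change (is_derive f2 t (P (dx (dy u)) r t * (- r * sin t) + P (dy (dy u)) r t * (r * cos t))) in Eyt.
    auto_derive; [repeat split; eexists; [apply Ext|apply Eyt]|].
    use_derive Ext. use_derive Eyt. ring.
  - change (laplacian u (r * cos t) (r * sin t)) with (P (dx (dx u)) r t + P (dy (dy u)) r t).
    assert (S := sin2_cos2 t). unfold Rsqr in S.
    transitivity (r ^ 2 * (P (dx (dx u)) r t + P (dy (dy u)) r t) * (sin t * sin t + cos t * cos t));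
      [|rewrite S]; ring.
Qed.

Lemma pseudo_radial_solution R1 R2 eps M N q u : 0 <= R1 -> eps <> 0 -> q <> 1 ->
  (forall r, in_range R1 R2 r -> 0 < M + N * ln r) ->
  classical_solution R1 R2 eps M N q u -> pseudo_radial R1 R2 u -> ~ radial R1 R2 u ->
  exists w w' : R -> R,
    (forall t, is_derive w t (w' t)) /\
    (forall t, is_derive w' t (eps * spow q (w t))) /\
    (forall t, w (t + 2 * PI) = w t) /\ (exists t, w t <> 0) /\
    (forall r t, in_range R1 R2 r -> u (r * cos t) (r * sin t) = (M + N * ln r) * w t).
Proof.
  intros H0 He Hq HL Hu [h [w [Hper Hhw]]] Hnr.
  assert (E : exists r ta tb, in_range R1 R2 r /\ h r * w ta <> h r * w tb).
  { apply Classical_Prop.NNPP. intros HN. apply Hnr. intros r t t' Hr. rewrite !Hhw by auto.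
    apply Classical_Prop.NNPP. intros HE. apply HN. now exists r, t, t'. }
  destruct E as [r0 [ta [tb [Hr0 Hne]]]].
  assert (Hh0 : h r0 <> 0) by (intros E; apply Hne; rewrite E; ring).
  assert (Hw : w ta <> w tb) by (intros E; apply Hne; now rewrite E).
  assert (Ht1 : exists t1, w t1 <> 0).
  { destruct (Req_dec (w ta) 0); [exists tb; congruence|now exists ta]. }
  destruct Ht1 as [t1 Ht1].
  destruct (polar_laplacian R1 R2 u H0 (fun x y Hx => proj1 (Hu x y Hx)))
    as [Ur [Urr [Ut [Utt HU]]]].
  (* Regularity of the factors comes from slices of [u]: along the ray [t = t1], where [w t1 <> 0],
     for [h], and along the circle [r = r0], where [h r0 <> 0], for [w]. *)
  assert (Dh : forall r, in_range R1 R2 r -> is_derive h r (Ur r t1 / w t1)).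
  { intros r Hr. destruct (HU r t1 Hr) as [D _].
    apply (is_derive_ext_loc (fun r => u (r * cos t1) (r * sin t1) / w t1)).
    - generalize (in_range_locally _ _ _ Hr). apply filter_imp. intros s Hs.
      rewrite Hhw by auto. now apply Rmult_div_l.
    - apply (is_derive_mult_const_r (fun r => u (r * cos t1) (r * sin t1))). exact D. }
  assert (Dh1 : forall r, in_range R1 R2 r -> is_derive (fun r => Ur r t1 / w t1) r (Urr r t1 / w t1)).
  { intros r Hr. destruct (HU r t1 Hr) as [_ [D _]].
    apply (is_derive_mult_const_r (fun r => Ur r t1)). exact D. }
  assert (Dw : forall t, is_derive w t (Ut r0 t / h r0)).
  { intros t. destruct (HU r0 t Hr0) as [_ [_ [D _]]].
    apply (is_derive_ext (fun t => u (r0 * cos t) (r0 * sin t) / h r0)).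
    - intros s. rewrite Hhw by auto. now apply Rmult_div_r.
    - apply (is_derive_mult_const_r (fun t => u (r0 * cos t) (r0 * sin t))). exact D. }
  assert (Dw1 : forall t, is_derive (fun t => Ut r0 t / h r0) t (Utt r0 t / h r0)).
  { intros t. destruct (HU r0 t Hr0) as [_ [_ [_ [D _]]]].
    apply (is_derive_mult_const_r (fun t => Ut r0 t)). exact D. }
  (* The derivatives of [u] factor as [u] does, which turns the polar equation into the separated
     form. *)
  assert (E1 : forall r t, in_range R1 R2 r -> Ur r t = Ur r t1 / w t1 * w t).
  { intros r t Hr. destruct (HU r t Hr) as [D _].
    rewrite <- (is_derive_unique _ _ _ D). apply is_derive_unique.
    apply (is_derive_ext_loc (fun r => h r * w t)).
    - generalize (in_range_locally _ _ _ Hr). apply filter_imp. intros s Hs. now rewrite Hhw.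
    - apply (is_derive_mult_const_r h). now apply Dh. }
  assert (E2 : forall r t, in_range R1 R2 r -> Urr r t = Urr r t1 / w t1 * w t).
  { intros r t Hr. destruct (HU r t Hr) as [_ [D _]].
    rewrite <- (is_derive_unique _ _ _ D). apply is_derive_unique.
    apply (is_derive_ext_loc (fun r => Ur r t1 / w t1 * w t)).
    - generalize (in_range_locally _ _ _ Hr). apply filter_imp. intros s Hs. symmetry; now apply E1.
    - apply (is_derive_mult_const_r (fun r => Ur r t1 / w t1)). now apply Dh1. }
  assert (E3 : forall r t, in_range R1 R2 r -> Ut r t = h r * (Ut r0 t / h r0)).
  { intros r t Hr. destruct (HU r t Hr) as [_ [_ [D _]]].
    rewrite <- (is_derive_unique _ _ _ D). apply is_derive_unique.
    apply (is_derive_ext (fun t => h r * w t)).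
    - intros s. now rewrite Hhw.
    - apply (is_derive_scal w). auto. }
  assert (E4 : forall r t, in_range R1 R2 r -> Utt r t = h r * (Utt r0 t / h r0)).
  { intros r t Hr. destruct (HU r t Hr) as [_ [_ [_ [D _]]]].
    rewrite <- (is_derive_unique _ _ _ D). apply is_derive_unique.
    apply (is_derive_ext (fun t => h r * (Ut r0 t / h r0))).
    - intros s. symmetry; now apply E3.
    - apply (is_derive_scal (fun t => Ut r0 t / h r0)). auto. }
  destruct (separation R1 R2 eps M N q h _ _ w _ (fun t => Utt r0 t / h r0) r0 ta tb
    H0 He Hq HL Dh Dh1 Dw) as [c [Hc [Hh HW]]]; auto.
  { intros r t Hr. destruct (HU r t Hr) as [_ [_ [_ [_ HE]]]].
    destruct (Hu _ _ (annulus_polar R1 R2 r t H0 Hr)) as [_ HE'].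
    assert (0 < r) by (destruct Hr; lra).
    rewrite HE', Hhw, radius_polar in HE by auto.
    rewrite E1, E2, E4 in HE by auto.
    transitivity (r ^ 2 * (eps * / r ^ 2 * Rpower (M + N * ln r) (1 - q) * spow q (h r * w t))).
    - rewrite <- HE. ring.
    - field. lra. }
  (* The constant [c] moves from the radial to the angular factor, leaving exactly
     [M + N * ln r]. *)
  exists (fun t => c * w t), (fun t => c * (Ut r0 t / h r0)). split; [|split; [|split; [|split]]].
  - intros t. now apply (is_derive_scal w).
  - intros t. rewrite <- HW. now apply (is_derive_scal (fun t => Ut r0 t / h r0)).
  - intros t. now rewrite Hper.
  - exists t1. now apply Rmult_integral_contrapositive.
  - intros r t Hr. rewrite Hhw, Hh by auto. ring.
Qed.

(** * Angular functions in Cartesian coordinates *)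

(** The cross product of the two equal vectors gives [sin (a - b) = 0], their scalar product
    [cos (a - b) > 0]. *)
Lemma same_direction r s a b : 0 < r -> 0 < s ->
  r * cos a = s * cos b -> r * sin a = s * sin b -> exists n : Z, a = b + IZR n * (2 * PI).
Proof.
  intros Hr Hs E1 E2. destruct (sin_0_cos_pos (a - b)) as [n Hn].
  - apply Rmult_eq_reg_l with r; [|lra]. rewrite sin_minus, Rmult_0_r.
    transitivity (r * sin a * cos b - r * cos a * sin b); [ring|]. rewrite E1, E2. ring.
  - apply Rmult_lt_reg_l with r; auto. rewrite cos_minus, Rmult_0_r.
    replace (r * (cos a * cos b + sin a * sin b))
      with (r * cos a * cos b + r * sin a * sin b) by ring.
    rewrite E1, E2. assert (S := sin2_cos2 b). unfold Rsqr in S. nra.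
  - exists n. lra.
Qed.

Lemma periodic_shift_Z (w : R -> R) T : (forall t, w (t + T) = w t) ->
  forall (n : Z) t, w (t + IZR n * T) = w t.
Proof.
  intros H n t. rewrite (shift_Z w T 0); [ring|]. intros x. rewrite H. ring.
Qed.

Lemma radius_pos x y : 0 < x * x + y * y -> 0 < radius x y.
Proof. intros H. apply sqrt_lt_R0. lra. Qed.

Lemma radius_sq x y : radius x y ^ 2 = x * x + y * y.
Proof.
  unfold radius. rewrite pow2_sqrt by nra. ring.
Qed.

Lemma periodic_polar_angle (w : R -> R) r t : (forall t, w (t + 2 * PI) = w t) -> 0 < r ->
  w (polar_angle (r * cos t) (r * sin t)) = w t.
Proof.
  intros Hw Hr. destruct (polar_angle_spec (r * cos t) (r * sin t)) as [E1 E2].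
  rewrite radius_polar in E1, E2 by auto.
  destruct (same_direction r r t _ Hr Hr E1 E2) as [n Hn].
  rewrite <- (periodic_shift_Z w (2 * PI) Hw n). now f_equal.
Qed.

(** The argument of the arctangent is cross product over scalar product, the tangent of the angle
    from [(x0, y0)] to [(x, y)]. On the half-plane around [(x0, y0)] this replaces [polar_angle] by
    a smooth branch, and periodicity absorbs the difference. *)
Lemma periodic_polar_angle_local (w : R -> R) x0 y0 x y :
  (forall t, w (t + 2 * PI) = w t) -> 0 < x0 * x + y0 * y ->
  w (polar_angle x y) =
  w (polar_angle x0 y0 + atan ((x0 * y - y0 * x) / (x0 * x + y0 * y))).
Proof.
  intros Hw HD.
  assert (HP : forall a b c d, 0 < a * c + b * d -> 0 < a * a + b * b).
  { intros a b c d Hp. destruct (Req_dec a 0) as [->|]; [|nra].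
    destruct (Req_dec b 0) as [->|]; [lra|nra]. }
  assert (Hr0 : 0 < radius x0 y0) by (apply radius_pos, (HP _ _ _ _ HD)).
  assert (Hr : 0 < radius x y) by (apply radius_pos, (HP _ _ x0 y0); lra).
  set (b := atan ((x0 * y - y0 * x) / (x0 * x + y0 * y))).
  assert (Hb : 0 < cos b).
  { apply cos_gt_0; unfold b; destruct (atan_bound ((x0 * y - y0 * x) / (x0 * x + y0 * y))); lra. }
  assert (Hsb : sin b = cos b * ((x0 * y - y0 * x) / (x0 * x + y0 * y))).
  { rewrite <- (tan_atan ((x0 * y - y0 * x) / (x0 * x + y0 * y))). fold b. unfold tan. field. lra. }
  destruct (polar_angle_spec x0 y0) as [E1 E2]. destruct (polar_angle_spec x y) as [E3 E4].
  set (p := polar_angle x y) in *. set (p0 := polar_angle x0 y0) in *.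
  set (r := radius x y) in *. set (r0 := radius x0 y0) in *.
  (* Both sides represent the complex number [(x - i y)] conjugated, times [x0 - i y0]: its real
     part is the scalar product, its imaginary part the cross product. *)
  destruct (same_direction (r0 * r) ((x0 * x + y0 * y) / cos b) (p - p0) b) as [n Hn].
  - nra.
  - now apply Rdiv_lt_0_compat.
  - rewrite cos_minus. transitivity (x0 * x + y0 * y); [|field; lra].
    rewrite E1, E2, E3, E4. ring.
  - rewrite Hsb, sin_minus. transitivity (x0 * y - y0 * x); [|field; lra].
    rewrite E1, E2, E3, E4. ring.
  - replace p with (p0 + b + IZR n * (2 * PI)) by lra. now apply periodic_shift_Z.
Qed.

Ltac continuity_2d :=
  repeat first
    [ solve [eauto] | apply continuity_2d_pt_plus | apply continuity_2d_pt_minus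
    | apply continuity_2d_pt_mult | apply continuity_2d_pt_opp
    | apply continuity_2d_pt_inv | apply continuity_2d_pt_id1
    | apply continuity_2d_pt_id2 | apply continuity_2d_pt_const ].

Lemma punctured_locally x y : 0 < x * x + y * y -> locally_2d (fun x y => 0 < x * x + y * y) x y.
Proof.
  intros H. apply locally_2d_locally.
  assert (C : continuity_2d_pt (fun x y => x * x + y * y) x y) by continuity_2d.
  apply (proj1 (continuity_2d_pt_filterlim _ x y) C). now apply open_gt.
Qed.

Lemma half_plane_locally x y : 0 < x * x + y * y ->
  locally_2d (fun u v => 0 < x * u + y * v) x y.
Proof.
  intros H. apply locally_2d_locally.
  assert (C : continuity_2d_pt (fun u v => x * u + y * v) x y) by continuity_2d.
  apply (proj1 (continuity_2d_pt_filterlim _ x y) C). now apply open_gt.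
Qed.

Lemma continuity_2d_angular (w : R -> R) x y :
  (forall t, w (t + 2 * PI) = w t) -> (forall t, continuous w t) -> 0 < x * x + y * y ->
  continuity_2d_pt (fun x y => w (polar_angle x y)) x y.
Proof.
  intros Hw Hc H.
  apply (continuity_2d_pt_ext_loc
    (fun u v => w (polar_angle x y + atan ((x * v - y * u) / (x * u + y * v))))).
  - generalize (half_plane_locally x y H). apply locally_2d_impl, locally_2d_forall.
    intros u v Huv. symmetry. now apply periodic_polar_angle_local.
  - apply (continuity_1d_2d_pt_comp (fun z => w (polar_angle x y + atan z))).
    + apply continuity_pt_filterlim.
      apply (continuous_comp (fun z => polar_angle x y + atan z) w); auto.
      apply (ex_derive_continuous (V := R_NormedModule) (fun z => polar_angle x y + atan z)).
      auto_derive. auto.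
    + unfold Rdiv. continuity_2d. lra.
Qed.

Lemma is_derive_angular (w w' : R -> R) x y :
  (forall t, w (t + 2 * PI) = w t) -> (forall t, is_derive w t (w' t)) -> 0 < x * x + y * y ->
  is_derive (fun z => w (polar_angle z y)) x (- y / (x * x + y * y) * w' (polar_angle x y)) /\
  is_derive (fun z => w (polar_angle x z)) y (x / (x * x + y * y) * w' (polar_angle x y)).
Proof.
  intros Hw Hd H.
  assert (Hl := half_plane_locally x y H).
  set (p := polar_angle x y).
  assert (E0 : p + atan ((x * y - y * x) / (x * x + y * y)) = p).
  { replace ((x * y - y * x) / (x * x + y * y)) with 0 by (field; lra). rewrite atan_0. ring. }
  assert (D := Hd p). rewrite <- E0 in D at 1. split.
  - apply (is_derive_ext_loc (fun z => w (p + atan ((x * y - y * z) / (x * z + y * y))))).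
    + generalize (locally_2d_1d_const_y _ _ _ Hl). apply filter_imp. intros z Hz.
      symmetry. now apply periodic_polar_angle_local.
    + auto_derive.
      * split; [eexists; apply D|]. split; [lra|auto].
      * unfold Rminus, Rdiv in E0. rewrite E0. use_derive (Hd p).
        replace (x * y + - (y * x)) with 0 by ring. field. lra.
  - apply (is_derive_ext_loc (fun z => w (p + atan ((x * z - y * x) / (x * x + y * z))))).
    + generalize (locally_2d_1d_const_x _ _ _ Hl). apply filter_imp. intros z Hz.
      symmetry. now apply periodic_polar_angle_local.
    + auto_derive.
      * split; [eexists; apply D|]. split; [lra|auto].
      * unfold Rminus, Rdiv in E0. rewrite E0. use_derive (Hd p).
        replace (x * y + - (y * x)) with 0 by ring. field. lra.
Qed.

(** Explicit formulas [fx], [fy] agree with the partial derivatives only off the origin; since that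
    set is open, regularity passes from the formulas to the derivatives. *)
Lemma ex_diff_n_S (f fx fy : R -> R -> R) n :
  (forall x y, 0 < x * x + y * y -> continuity_2d_pt f x y /\
     is_derive (fun z => f z y) x (fx x y) /\ is_derive (fun z => f x z) y (fy x y)) ->
  (forall x y, 0 < x * x + y * y -> ex_diff_n fx n x y) ->
  (forall x y, 0 < x * x + y * y -> ex_diff_n fy n x y) ->
  forall x y, 0 < x * x + y * y -> ex_diff_n f (S n) x y.
Proof.
  intros Hf Hx Hy x y H. destruct (Hf x y H) as [C [Dx Dy]].
  split; [exact C|]. split; [eexists; apply Dx|]. split; [eexists; apply Dy|].
  split; [apply (ex_diff_n_ext_loc fx)|apply (ex_diff_n_ext_loc fy)]; auto;
    generalize (punctured_locally x y H); apply locally_2d_impl, locally_2d_forall;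
    intros u v Huv; destruct (Hf u v Huv) as [_ [Du Dv]];
    symmetry; now apply is_derive_unique.
Qed.

(** In the Laplacian of the product, the logarithmic factor is harmonic and its gradient is
    orthogonal to that of the angular factor, so only [w2] over the squared radius survives. *)
Lemma profile_derivatives (M N : R) (w w1 w2 : R -> R) :
  (forall t, w (t + 2 * PI) = w t) ->
  (forall t, is_derive w t (w1 t)) -> (forall t, is_derive w1 t (w2 t)) ->
  (forall t, continuous w2 t) ->
  forall x y, 0 < x * x + y * y ->
    ex_diff_n (profile_function M N w) 2 x y /\
    laplacian (profile_function M N w) x y =
      (M + N * ln (radius x y)) * w2 (polar_angle x y) / (x * x + y * y).
Proof.
  intros Hw Dw Dw1 Cw2.
  assert (Hw1 := derive_periodic w w1 _ Dw Hw).
  assert (Hw2 := derive_periodic w1 w2 _ Dw1 Hw1).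
  set (l := fun x y => M + N * ln (radius x y)).
  set (a := fun x y => w (polar_angle x y)).
  set (b := fun x y => w1 (polar_angle x y)).
  set (c := fun x y => w2 (polar_angle x y)).
  set (s := fun x y : R => x * x + y * y).
  set (f := fun x y => l x y * a x y).
  set (fx := fun x y => (N * x * a x y - y * l x y * b x y) / s x y).
  set (fy := fun x y => (N * y * a x y + x * l x y * b x y) / s x y).
  set (fxx := fun x y => (N * a x y - 2 * (N * x * y / s x y) * b x y + y * y * l x y * c x y / s x y) / s x y
      - 2 * x * fx x y / s x y).
  set (fxy := fun x y => (N * (x * x - y * y) / s x y * b x y - l x y * b x y - x * y * l x y * c x y / s x y) / s x y
      - 2 * y * fx x y / s x y).
  set (fyx := fun x y => (N * (x * x - y * y) / s x y * b x y + l x y * b x y - x * y * l x y * c x y / s x y) / s x y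
      - 2 * x * fy x y / s x y).
  set (fyy := fun x y => (N * a x y + 2 * (N * x * y / s x y) * b x y + x * x * l x y * c x y / s x y) / s x y
      - 2 * y * fy x y / s x y).
  assert (Cl : forall x y, 0 < s x y -> continuity_2d_pt l x y).
  { intros x y H. unfold l. continuity_2d. apply (continuity_1d_2d_pt_comp ln).
    - apply continuity_pt_filterlim, continuous_ln, radius_pos, H.
    - apply continuity_2d_radius. }
  assert (Cont : forall v v' : R -> R, (forall t, is_derive v t (v' t)) -> forall t, continuous v t).
  { intros v v' D t. apply (ex_derive_continuous (V := R_NormedModule) v). eexists; apply D. }
  assert (Ca : forall x y, 0 < s x y -> continuity_2d_pt a x y)
    by (intros; apply continuity_2d_angular; eauto).
  assert (Cb : forall x y, 0 < s x y -> continuity_2d_pt b x y)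
    by (intros; apply continuity_2d_angular; eauto).
  assert (Cc : forall x y, 0 < s x y -> continuity_2d_pt c x y)
    by (intros; apply continuity_2d_angular; auto).
  assert (Dl : forall x y, 0 < s x y ->
     is_derive (fun z => l z y) x (N * x / s x y) /\ is_derive (fun z => l x z) y (N * y / s x y)).
  { intros x y H. assert (Hr := radius_pos x y H). assert (Hr2 := radius_sq x y).
    unfold l, radius in *. unfold s in *. split.
    - auto_derive; [split; [nra|split; [exact Hr|auto]]|].
      change (x * (x * 1) + y * (y * 1)) with (x ^ 2 + y ^ 2). rewrite <- Hr2. field. lra.
    - auto_derive; [split; [nra|split; [exact Hr|auto]]|].
      change (x * (x * 1) + y * (y * 1)) with (x ^ 2 + y ^ 2). rewrite <- Hr2. field. lra. }
  assert (Da : forall x y, 0 < s x y ->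
    is_derive (fun z => a z y) x (- y / s x y * b x y) /\
    is_derive (fun z => a x z) y (x / s x y * b x y)) by (intros; now apply is_derive_angular).
  assert (Db : forall x y, 0 < s x y ->
    is_derive (fun z => b z y) x (- y / s x y * c x y) /\
    is_derive (fun z => b x z) y (x / s x y * c x y)) by (intros; now apply is_derive_angular).
  assert (Cf : forall x y, 0 < s x y -> continuity_2d_pt f x y /\
     is_derive (fun z => f z y) x (fx x y) /\ is_derive (fun z => f x z) y (fy x y)).
  { intros x y H. destruct (Dl x y H) as [Dlx Dly]. destruct (Da x y H) as [Dax Day].
    split; [apply continuity_2d_pt_mult; auto|]. split.
    - set (l' := fun z => l z y) in *. set (a' := fun z => a z y) in *.
      change (is_derive l' x (N * x / s x y)) in Dlx.
      change (is_derive a' x (- y / s x y * b x y)) in Dax.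
      change (is_derive (fun z => l' z * a' z) x (fx x y)).
      auto_derive; [repeat split; eexists; [apply Dlx|apply Dax]|].
      use_derive Dlx. use_derive Dax. unfold l', a', fx. field. lra.
    - set (l' := fun z => l x z) in *. set (a' := fun z => a x z) in *.
      change (is_derive l' y (N * y / s x y)) in Dly.
      change (is_derive a' y (x / s x y * b x y)) in Day.
      change (is_derive (fun z => l' z * a' z) y (fy x y)).
      auto_derive; [repeat split; eexists; [apply Dly|apply Day]|].
      use_derive Dly. use_derive Day. unfold l', a', fy. field. lra. }
  assert (Cfx : forall x y, 0 < s x y -> continuity_2d_pt fx x y /\
     is_derive (fun z => fx z y) x (fxx x y) /\ is_derive (fun z => fx x z) y (fxy x y)).
  { intros x y H. destruct (Dl x y H) as [Dlx Dly]. destruct (Da x y H) as [Dax Day].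
    destruct (Db x y H) as [Dbx Dby].
    split; [unfold fx, Rdiv, s in *; continuity_2d; auto; lra|]. split.
    - set (l' := fun z => l z y) in *. set (a' := fun z => a z y) in *.
      set (b' := fun z => b z y) in *.
      change (is_derive l' x (N * x / s x y)) in Dlx.
      change (is_derive a' x (- y / s x y * b x y)) in Dax.
      change (is_derive b' x (- y / s x y * c x y)) in Dbx.
      change (is_derive (fun z => (N * z * a' z - y * l' z * b' z) / (z * z + y * y)) x (fxx x y)).
      auto_derive.
      + split; [eexists; apply Dax|]. split; [eexists; apply Dlx|].
        split; [eexists; apply Dbx|]. unfold s in H. split; [lra|auto].
      + use_derive Dlx. use_derive Dax. use_derive Dbx. unfold l', a', b', fxx, fx, s in *. field. lra.
    - set (l' := fun z => l x z) in *. set (a' := fun z => a x z) in *.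
      set (b' := fun z => b x z) in *.
      change (is_derive l' y (N * y / s x y)) in Dly.
      change (is_derive a' y (x / s x y * b x y)) in Day.
      change (is_derive b' y (x / s x y * c x y)) in Dby.
      change (is_derive (fun z => (N * x * a' z - z * l' z * b' z) / (x * x + z * z)) y (fxy x y)).
      auto_derive.
      + split; [eexists; apply Day|]. split; [eexists; apply Dly|].
        split; [eexists; apply Dby|]. unfold s in H. split; [lra|auto].
      + use_derive Dly. use_derive Day. use_derive Dby. unfold l', a', b', fxy, fx, s in *. field. lra. }
  assert (Cfy : forall x y, 0 < s x y -> continuity_2d_pt fy x y /\
     is_derive (fun z => fy z y) x (fyx x y) /\ is_derive (fun z => fy x z) y (fyy x y)).
  { intros x y H. destruct (Dl x y H) as [Dlx Dly]. destruct (Da x y H) as [Dax Day].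
    destruct (Db x y H) as [Dbx Dby].
    split; [unfold fy, Rdiv, s in *; continuity_2d; auto; lra|]. split.
    - set (l' := fun z => l z y) in *. set (a' := fun z => a z y) in *.
      set (b' := fun z => b z y) in *.
      change (is_derive l' x (N * x / s x y)) in Dlx.
      change (is_derive a' x (- y / s x y * b x y)) in Dax.
      change (is_derive b' x (- y / s x y * c x y)) in Dbx.
      change (is_derive (fun z => (N * y * a' z + z * l' z * b' z) / (z * z + y * y)) x (fyx x y)).
      auto_derive.
      + split; [eexists; apply Dax|]. split; [eexists; apply Dlx|].
        split; [eexists; apply Dbx|]. unfold s in H. split; [lra|auto].
      + use_derive Dlx. use_derive Dax. use_derive Dbx. unfold l', a', b', fyx, fy, s in *. field. lra.
    - set (l' := fun z => l x z) in *. set (a' := fun z => a x z) in *.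
      set (b' := fun z => b x z) in *.
      change (is_derive l' y (N * y / s x y)) in Dly.
      change (is_derive a' y (x / s x y * b x y)) in Day.
      change (is_derive b' y (x / s x y * c x y)) in Dby.
      change (is_derive (fun z => (N * z * a' z + x * l' z * b' z) / (x * x + z * z)) y (fyy x y)).
      auto_derive.
      + split; [eexists; apply Day|]. split; [eexists; apply Dly|].
        split; [eexists; apply Dby|]. unfold s in H. split; [lra|auto].
      + use_derive Dly. use_derive Day. use_derive Dby. unfold l', a', b', fyy, fy, s in *. field. lra. }
  assert (C2 : forall x y, 0 < s x y -> continuity_2d_pt fxx x y /\ continuity_2d_pt fxy x y /\
     continuity_2d_pt fyx x y /\ continuity_2d_pt fyy x y).
  { intros x y H. destruct (Cfx x y H) as [Hx _]. destruct (Cfy x y H) as [Hy _].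
    unfold fxx, fxy, fyx, fyy, Rdiv. repeat split; continuity_2d; auto; unfold s in *;
    continuity_2d; lra. }
  intros x y H. split.
  - apply (ex_diff_n_S f fx fy 1); auto.
    + apply (ex_diff_n_S fx fxx fxy 0); auto; intros u v Huv; split; auto; now apply C2.
    + apply (ex_diff_n_S fy fyx fyy 0); auto; intros u v Huv; split; auto; now apply C2.
  - assert (Ex : Derive (fun z => Derive (fun t => f t y) z) x = fxx x y).
    { apply is_derive_unique. apply (is_derive_ext_loc (fun z => fx z y)).
      - generalize (locally_2d_1d_const_y _ _ _ (punctured_locally x y H)).
        apply filter_imp. intros z Hz. symmetry. apply is_derive_unique.
        now apply Cf.
      - now apply Cfx. }
    assert (Ey : Derive (fun z => Derive (fun t => f x t) z) y = fyy x y).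
    { apply is_derive_unique. apply (is_derive_ext_loc (fun z => fy x z)).
      - generalize (locally_2d_1d_const_x _ _ _ (punctured_locally x y H)).
        apply filter_imp. intros z Hz. symmetry. apply is_derive_unique.
        now apply Cf.
      - now apply Cfy. }
    transitivity (fxx x y + fyy x y); [rewrite <- Ex, <- Ey; reflexivity|].
    fold (l x y) (c x y). unfold fxx, fyy, fx, fy, s. field. unfold s in H. lra.
Qed.

(** * Classification *)

Lemma profile_function_polar M N (w : R -> R) r t :
  (forall t, w (t + 2 * PI) = w t) -> 0 < r ->
  profile_function M N w (r * cos t) (r * sin t) = (M + N * ln r) * w t.
Proof.
  intros Hw Hr. unfold profile_function.
  now rewrite radius_polar, periodic_polar_angle.
Qed.

(** Rotating the point by [a] adds [a] to its angle, and the periodicity of [w] makes the branch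
    chosen by [polar_angle] irrelevant. *)
Lemma eq_up_to_sign_and_rotation_polar R1 R2 M N u (w : R -> R) :
  0 <= R1 -> (forall t, w (t + 2 * PI) = w t) ->
  eq_up_to_sign_and_rotation R1 R2 u (profile_function M N w) <->
  exists s a, (s = 1 \/ s = -1) /\ forall r t, in_range R1 R2 r ->
    u (r * cos t) (r * sin t) = s * ((M + N * ln r) * w (t + a)).
Proof.
  intros H0 Hw.
  assert (Hrot : forall r t a, in_range R1 R2 r ->
    profile_function M N w (r * cos t * cos a - r * sin t * sin a) (r * cos t * sin a + r * sin t * cos a)
    = (M + N * ln r) * w (t + a)).
  { intros r t a [Hr _]. rewrite <- (profile_function_polar M N w r (t + a)) by (auto; lra).
    rewrite cos_plus, sin_plus. f_equal; ring. }
  split; intros [s [a [Hs Hu]]]; exists s, a; split; auto.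
  - intros r t Hr. rewrite Hu by now apply annulus_polar. now rewrite Hrot.
  - intros x y Hxy. destruct (polar_angle_spec x y) as [Ex Ey].
    change (in_range R1 R2 (radius x y)) in Hxy.
    set (r := radius x y) in *. set (p := polar_angle x y) in *. clearbody r p.
    rewrite Ex, Ey, Hrot by exact Hxy. now apply Hu.
Qed.

Lemma periodic_profile_2PI q k w : (1 <= k)%nat -> periodic_profile q k w ->
  forall t, w (t + 2 * PI) = w t.
Proof.
  intros Hk [_ [_ [[_ HP] _]]] t.
  assert (Hk0 : 0 < INR k) by (apply lt_0_INR; lia).
  rewrite <- (periodic_shift_Z w _ HP (Z.of_nat k) t). f_equal.
  rewrite <- INR_IZR_INZ. field. lra.
Qed.

Lemma positive_period_translate (v w : R -> R) s a T : s <> 0 ->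
  (forall t, v t = s * w (t + a)) -> positive_period v T -> positive_period w T.
Proof.
  intros Hs E [HT P]. split; auto. intros t.
  specialize (P (t - a)). rewrite !E in P. apply Rmult_eq_reg_l in P; auto.
  replace (t - a + T + a) with (t + T) in P by ring.
  now replace (t - a + a) with t in P by ring.
Qed.

(** A nonzero factor and a translation preserve the set of periods, so the two least periods bound
    each other. *)
Lemma periodic_profile_index q k k' v w s a : (1 <= k)%nat -> (1 <= k')%nat -> s <> 0 ->
  periodic_profile q k v -> periodic_profile q k' w ->
  (forall t, v t = s * w (t + a)) -> k = k'.
Proof.
  intros Hk Hk' Hs [_ [_ [Pv Mv]]] [_ [_ [Pw Mw]]] E.
  assert (E' : forall t, w t = / s * v (t + - a)).
  { intros t. rewrite E. replace (t + - a + a) with t by ring. field. auto. }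
  assert (H1 := Mw _ (positive_period_translate v w s a _ Hs E Pv)).
  assert (H2 := Mv _ (positive_period_translate w v (/ s) (- a) _ (Rinv_neq_0_compat _ Hs) E' Pw)).
  assert (Hk0 : 0 < INR k) by (apply lt_0_INR; lia).
  assert (Hk0' : 0 < INR k') by (apply lt_0_INR; lia).
  assert (HPI := PI_RGT_0).
  apply INR_eq. assert (H : 2 * PI / INR k = 2 * PI / INR k') by lra.
  apply Rinv_eq_reg. apply Rmult_eq_reg_l with (2 * PI); [exact H|lra].
Qed.

(* [w w'] is periodic with derivative [w'^2 + |w|^(q+1) >= 0], hence constant. *)
Lemma periodic_repulsive_zero q (w w' : R -> R) T : 0 < T ->
  (forall t, is_derive w t (w' t)) -> (forall t, is_derive w' t (spow q (w t))) ->
  (forall t, w (t + T) = w t) -> forall t, w t = 0.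
Proof.
  intros HT Dw Dw' Hw t.
  assert (Hw' := derive_periodic w w' T Dw Hw).
  set (F := fun t => w t * w' t). set (f := fun t => w' t ^ 2 + apow q (w t)).
  assert (DF : forall t, is_derive F t (f t)).
  { intros s. unfold F. auto_derive; [repeat split; eexists; [apply Dw|apply Dw']|].
    use_derive (Dw s). use_derive (Dw' s). unfold f, apow. ring. }
  assert (Hf : forall t, 0 <= f t).
  { intros s. unfold f. assert (H := apow_nonneg q (w s)). nra. }
  assert (Hinc : forall a b, a <= b -> F a <= F b).
  { intros a b [l| ->]; [|lra].
    destruct (MVT_cor2 F f a b l) as [c [E _]].
    { intros c _. now apply is_derive_Reals. }
    specialize (Hf c). nra. }
  assert (HF : forall s, t - T / 2 <= s <= t + T / 2 -> F s = F (t - T / 2)).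
  { intros s Hs. apply Rle_antisym; [|now apply Hinc].
    apply Rle_trans with (F (t + T / 2)); [now apply Hinc|].
    replace (t + T / 2) with (t - T / 2 + T) by field. unfold F. rewrite Hw, Hw'. lra. }
  assert (Hft : f t = 0).
  { rewrite <- (is_derive_unique F t (f t) (DF t)). apply is_derive_unique.
    apply (is_derive_ext_loc (fun _ => F (t - T / 2))).
    - assert (HT2 : 0 < T / 2) by lra.
      exists (mkposreal _ HT2). intros s Hs. apply Rabs_def2 in Hs.
      unfold minus, plus, opp in Hs; simpl in Hs. symmetry. apply HF. lra.
    - apply (is_derive_const (V := R_NormedModule)). }
  destruct (Req_dec (w t) 0) as [|Hwt]; auto.
  assert (H := apow_pos q _ Hwt). unfold f in Hft. nra.
Qed.

(** Since [spow] is odd, sign and shift can be absorbed into one periodic solution [v]. The equation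
    then follows from the Laplacian of its profile and [L^(1-q) L^q = L]. *)
Lemma profile_solution R1 R2 M N q u s a (w : R -> R) : 0 <= R1 -> 0 < q ->
  (forall r, in_range R1 R2 r -> 0 < M + N * ln r) -> (s = 1 \/ s = -1) ->
  ode_solution q w -> (forall t, w (t + 2 * PI) = w t) ->
  (forall r t, in_range R1 R2 r ->
    u (r * cos t) (r * sin t) = s * ((M + N * ln r) * w (t + a))) ->
  classical_solution R1 R2 (-1) M N q u.
Proof.
  intros H0 Hq HL Hs [Hw Hw'] Hper Hu.
  assert (Hss : forall x, spow q (s * x) = s * spow q x).
  { intros x. destruct Hs as [-> | ->].
    - now rewrite !Rmult_1_l.
    - replace (-1 * x) with (- x) by ring. rewrite spow_opp. ring. }
  set (v := fun t => s * w (t + a)).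
  assert (Hv : forall t, v (t + 2 * PI) = v t).
  { intros t. unfold v. rewrite <- (Hper (t + a)). do 2 f_equal. ring. }
  assert (Dv : forall t, is_derive v t (s * Derive w (t + a))).
  { intros t. unfold v. assert (D := Derive_correct w (t + a) (Hw (t + a))).
    auto_derive; [apply Hw|]. use_derive D. ring. }
  assert (Dv' : forall t, is_derive (fun t => s * Derive w (t + a)) t (- spow q (v t))).
  { intros t. unfold v. rewrite Hss. assert (D := Hw' (t + a)).
    set (w' := Derive w) in *. auto_derive; [eexists; apply D|]. use_derive D. ring. }
  assert (Cv : forall t, continuous (fun t => - spow q (v t)) t).
  { intros t. apply (continuous_opp (V := R_NormedModule) (fun t => spow q (v t))).
    apply (continuous_comp v (spow q)); [|now apply continuous_spow].
    apply (ex_derive_continuous (V := R_NormedModule) v). eexists; apply Dv. }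
  assert (Eu : forall x y, annulus R1 R2 x y -> u x y = profile_function M N v x y).
  { intros x y Hxy. destruct (polar_angle_spec x y) as [Ex Ey].
    transitivity (u (radius x y * cos (polar_angle x y)) (radius x y * sin (polar_angle x y)));
      [now f_equal|].
    rewrite Hu by exact Hxy. unfold profile_function, v. ring. }
  intros x y Hxy.
  assert (Hr : 0 < radius x y) by (destruct Hxy; lra).
  assert (Hs2 : 0 < x * x + y * y) by (rewrite <- radius_sq; nra).
  destruct (profile_derivatives M N v _ _ Hv Dv Dv' Cv x y Hs2) as [HE HD].
  assert (Hloc : locally_2d (fun x y => profile_function M N v x y = u x y) x y).
  { generalize (annulus_locally _ _ _ _ Hxy). apply locally_2d_impl, locally_2d_forall.
    intros x' y' H'. symmetry. now apply Eu. }
  split; [now apply (ex_diff_n_ext_loc (profile_function M N v))|].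
  transitivity (laplacian (profile_function M N v) x y).
  { unfold laplacian. f_equal; symmetry; now apply partial_derive_ext_loc. }
  assert (HLr := HL _ Hxy).
  rewrite HD, Eu by auto. unfold profile_function at 1.
  rewrite spow_scal by auto. rewrite radius_sq.
  transitivity (- (Rpower (M + N * ln (radius x y)) (1 - q) * Rpower (M + N * ln (radius x y)) q)
     * spow q (v (polar_angle x y)) / (x * x + y * y)); [|field; lra].
  rewrite <- Rpower_plus. replace (1 - q + q) with 1 by ring. rewrite Rpower_1 by auto.
  field. lra.
Qed.

Theorem theorem4 (R1 : R) (R2 : Rbar) (eps M N : R)
    (HR1 : 0 <= R1) (HR12 : Rbar_lt R1 R2)
    (Heps : eps = 1 \/ eps = -1)
    (Hpos : forall r : R, in_range R1 R2 r -> 0 < M + N * ln r) :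
  (eps = 1 ->
   forall q : R, 0 < q -> q <> 1 ->
   forall u : R -> R -> R,
     classical_solution R1 R2 eps M N q u ->
     pseudo_radial R1 R2 u ->
     radial R1 R2 u)
  /\
  (eps = -1 ->
   forall q : R, 0 < q -> q <> 1 ->
     (forall k : nat, (1 <= k)%nat ->
        exists w : R -> R, periodic_profile q k w /\
          forall v : R -> R, periodic_profile q k v ->
            exists s a : R, (s = 1 \/ s = -1) /\
              forall t : R, v t = s * w (t + a))
     /\
     (forall w : nat -> R -> R,
        (forall k : nat, (1 <= k)%nat -> periodic_profile q k (w k)) ->
        (forall u : R -> R -> R,
           (classical_solution R1 R2 eps M N q u /\
            pseudo_radial R1 R2 u /\ ~ radial R1 R2 u) <->
           (exists k : nat, (1 <= k)%nat /\
              eq_up_to_sign_and_rotation R1 R2 u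
                (profile_function M N (w k))))
        /\
        (forall k k' : nat, (1 <= k)%nat -> (1 <= k')%nat ->
           eq_up_to_sign_and_rotation R1 R2
             (profile_function M N (w k)) (profile_function M N (w k')) ->
           k = k'))).
Proof.
  split; intros He q Hq Hq1; subst eps.
  - intros u Hu Hp. apply Classical_Prop.NNPP. intros Hnr.
    destruct (pseudo_radial_solution R1 R2 1 M N q u HR1 R1_neq_R0 Hq1 Hpos Hu Hp Hnr)
      as [w [w' [Dw [Dw' [Hw [[t Ht] _]]]]]].
    apply Ht. apply (periodic_repulsive_zero q w w' (2 * PI)); auto.
    + assert (H := PI_RGT_0). lra.
    + intros s. rewrite <- (Rmult_1_l (spow q (w s))). apply Dw'.
  - destruct (periodic_solutions q Hq Hq1) as [om [Hom Huniq]].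
    (* The classification gives a translate of some [om k'], and comparing least periods identifies
       [k'] with [k]. Opposite solutions have equal energy and are translates of each other, hence
       the sign [1] below. *)
    assert (Hprof : forall k v, (1 <= k)%nat -> periodic_profile q k v ->
      exists a, forall t, v t = om k (t + a)).
    { intros k v Hk Hv. assert (Hv2 := periodic_profile_2PI q k v Hk Hv).
      assert (Hv0 := Hv). destruct Hv0 as [Ov [[[t Ht] _] _]].
      destruct (Huniq v Ov) as [k' [a [Hk' E]]]; auto.
      { exists t. lra. }
      exists a. assert (Ekk : k = k').
      { apply (periodic_profile_index q k k' v (om k') 1 a); auto using R1_neq_R0.
        intros s. rewrite Rmult_1_l. apply E. }
      now subst k'. }
    split.
    + intros k Hk. exists (om k). split; [auto|]. intros v Hv.
      destruct (Hprof k v Hk Hv) as [a Ha]. exists 1, a. split; [auto|].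
      intros t. rewrite Rmult_1_l. apply Ha.
    + intros w Hw.
      assert (Hw2 : forall k, (1 <= k)%nat -> forall t, w k (t + 2 * PI) = w k t)
        by (intros k Hk; apply (periodic_profile_2PI q k); auto).
      split.
      * intros u. split.
        -- intros [Hu [Hp Hnr]].
           assert (Hm1 : -1 <> 0) by lra.
           destruct (pseudo_radial_solution R1 R2 (-1) M N q u HR1 Hm1 Hq1 Hpos Hu Hp Hnr)
             as [v [v' [Dv [Dv' [Hv [Hnz Huv]]]]]].
           destruct (Huniq v) as [k [a [Hk Ea]]]; auto.
           { split; [intros t; eexists; apply Dv|]. intros t.
             apply (is_derive_ext v').
             - intros s. symmetry. now apply is_derive_unique.
             - replace (- spow q (v t)) with (-1 * spow q (v t)) by ring. apply Dv'. }
           exists k. split; auto. apply eq_up_to_sign_and_rotation_polar; auto.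
           destruct (Hprof k (w k) Hk (Hw k Hk)) as [b Eb].
           exists 1, (a - b). split; [auto|]. intros r t Hr.
           rewrite Huv, Ea, Eb, Rmult_1_l by auto. do 2 f_equal. ring.
        -- intros [k [Hk HE]].
           apply eq_up_to_sign_and_rotation_polar in HE; auto.
           destruct HE as [s [a [Hs Hu]]].
           destruct (Hw k Hk) as [Ow [[[tp Htp] [tn Htn]] _]].
           split; [|split].
           ++ now apply (profile_solution R1 R2 M N q u s a (w k)); auto.
           ++ exists (fun r => M + N * ln r), (fun t => s * w k (t + a)). split.
              ** intros t. f_equal. rewrite <- (Hw2 k Hk (t + a)). f_equal. ring.
              ** intros r t Hr. rewrite Hu by auto. ring.
           (* On a single circle, the angles where [w k] is positive and negative already give
              different values of [u]. *)
           ++ intros Hrad. destruct (in_range_inhabited R1 R2 HR12) as [r Hr].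
              specialize (Hrad r (tp - a) (tn - a) Hr). rewrite !Hu in Hrad by auto.
              replace (tp - a + a) with tp in Hrad by ring.
              replace (tn - a + a) with tn in Hrad by ring.
              specialize (Hpos r Hr).
              apply Rmult_eq_reg_l in Hrad; [|destruct Hs; lra].
              apply Rmult_eq_reg_l in Hrad; lra.
      * intros k k' Hk Hk' HE.
        apply eq_up_to_sign_and_rotation_polar in HE; auto.
        destruct HE as [s [a [Hs E]]].
        destruct (in_range_inhabited R1 R2 HR12) as [r Hr].
        apply (periodic_profile_index q k k' (w k) (w k') s a); auto.
        { destruct Hs; lra. }
        intros t. specialize (E r t Hr). specialize (Hpos r Hr).
        rewrite profile_function_polar in E by (auto; destruct Hr; lra).
        apply Rmult_eq_reg_l with (M + N * ln r); [|lra]. rewrite E. ring.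
Qed.
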